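(* Let $\Bbbk$ be a field of characteristic zero, $t\in\Bbbk$ and $n\in\mathbb N\cup\{\infty\}$. The category $\mathcal P_t$ is a full subcategory of the parabolic category $\mathcal O^{\mathfrak p}$ for $\mathfrak{gl}_n(\Bbbk)$.
   Context: Write $[1,n]=\{1,\dots,n\}$ and $[1,\infty]=\mathbb N$. $\mathfrak{gl}_n(\Bbbk)$ is the general linear Lie algebra of $n\times n$ matrices over $\Bbbk$ (with all but finitely many entries zero if $n=\infty$). It has matrix units $E_{i,j}$, Cartan subalgebra $\mathfrak h$ of diagonal matrices, $\varepsilon_i:\mathfrak h\to\Bbbk$ the $i$th diagonal entry, roots $\alpha_{i,j}=\varepsilon_i-\varepsilon_j$ ($i\ne j$ in $[1,n]$) with root vector $E_{i,j}$, and positive roots those with $i<j$. $\mathfrak l\cong\mathfrak{gl}_1(\Bbbk)\oplus\mathfrak{gl}_{n-1}(\Bbbk)$ is the Levi subalgebra spanned by $\mathfrak h$ and the $E_{i,j}$ with $i\ne j$ and $i,j\ge2$; $\mathfrak p=\mathfrak p^{+}$ is the parabolic subalgebra spanned by $\mathfrak l$ and the $E_{i,j}$ with $i<j$; $\mathfrak u^{+}$ is the nilpotent subalgebra spanned by the $E_{1,j}$ with $j\ge2$. $\mathcal O^{\mathfrak p}$ is the full subcategory of $U(\mathfrak{gl}_n(\Bbbk))$-modules $M$ such that: (P1) $M$ is finitely generated over $U(\mathfrak{gl}_n(\Bbbk))$; (P2) the restriction of $M$ to $U(\mathfrak l)$ is isomorphic to a direct sum of finite-dimensional simple $U(\mathfrak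 l)$-modules; (P3) every element of $M$ generates a finite-dimensional $U(\mathfrak u^{+})$-module. $\Lambda(n)_t$ is the set of $\beta=(\beta_i)_{i\in[1,n]}$ with $\beta_1\in t-\mathbb Z$, $\beta_i\in\mathbb Z_{\ge0}$ for $i\ge2$ (all but finitely many $\beta_i$ equal to zero if $n=\infty$) and $\sum_i\beta_i=t$, identified with the weights $\sum_i\beta_i\varepsilon_i$. $\mathcal P_t$ is the full subcategory of finitely generated $U(\mathfrak{gl}_n(\Bbbk))$-modules which have a weight space decomposition with respect to $\mathfrak h$ with all weights in $\Lambda(n)_t$.
   Formalization: For n=∞ the claim fails as written (the natural module lies in P_1 but is not a sum of finite-dimensional simple l-modules), so there (P2) only asks that the simple l-summands be locally finite over the Levi part of each gl_m, m finite; for finite n it is unchanged. *)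

(* Defs.v *)
From HB Require Import structures.
From mathcomp Require Export all_boot all_order all_algebra.
From mathcomp Require Export finmap.
From mathcomp.multinomials Require Export monalg.

Set Implicit Arguments.
Unset Strict Implicit.
Unset Printing Implicit Defensive.

Import GRing.Theory.
Local Open Scope ring_scope.

(* The rank n in {1, 2, ...} \cup {oo} is n : option nat, with None for oo;
   [1,n] keeps its 1-based numbering. *)
Definition idx (n : option nat) : choiceType :=
  {i : nat | (0 < i)%N && (if n is Some m then (i <= m)%N else true)}.

(* gl_n(k): finitely supported [1,n] x [1,n] matrices; the (i,j) entry of A
   is A@_(i, j). *)
Notation gl k n := {malg k[(idx n * idx n)%type]}.

Section GeneralLinear.
Variables (k : fieldType) (n : option nat).
Implicit Types A B : gl k n.

Definition gl_mul A B : gl k n :=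
  \sum_(p <- msupp A) \sum_(q <- msupp B)
     << A@_p * B@_q *+ (p.2 == q.1) *g (p.1, q.2) >>.

Definition gl_bracket A B : gl k n := gl_mul A B - gl_mul B A.

(* The span of the matrix units E_(i,j) such that P i j. *)
Definition unit_span (P : rel nat) : pred (gl k n) :=
  fun A => all (fun p : idx n * idx n => P (val p.1) (val p.2)) (msupp A).

Definition gl_all := unit_span (fun _ _ => true).
Definition cartan := unit_span (fun i j => i == j).
Definition levi :=
  unit_span (fun i j => (i == j) || (2 <= i)%N && (2 <= j)%N).
Definition nil_plus := unit_span (fun i j => (i == 1%N) && (2 <= j)%N).
Definition levi_upto (m : nat) :=
  unit_span (fun i j => [&& (i == j) || (2 <= i)%N && (2 <= j)%N,
                            (i <= m)%N & (j <= m)%N]).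

End GeneralLinear.

(* A U(gl_n)-module is given as a representation of the Lie algebra gl_n. *)
Record glmod (k : fieldType) (n : option nat) := GlMod {
  carrier :> lmodType k;
  act : gl k n -> carrier -> carrier;
  act_linear : forall A, linear (act A);
  act_linearl : forall v, linear (act^~ v);
  act_bracket : forall A B v,
    act (gl_bracket A B) v = act A (act B v) - act B (act A v) }.

(* Subspaces of a module are predicates, and a Lie subalgebra of gl_n is
   given by the predicate g of its elements. *)
Section Modules.
Variables (k : fieldType) (n : option nat) (M : glmod k n).
Implicit Types (g : pred (gl k n)) (N L S : M -> Prop).

(* N is a U(g)-submodule of the restriction of M. *)
Definition submodule g N : Prop :=
  [/\ N 0, forall (a : k) u v, N u -> N v -> N (a *: u + v)
    & forall A v, g A -> N v -> N (act A v)].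

Definition generated g S : M -> Prop :=
  fun v => forall N, submodule g N -> (forall u, S u -> N u) -> N v.

Definition fin_gen g : Prop :=
  exists s : seq M, forall v, generated g (fun u => u \in s) v.

Definition fin_dim N : Prop :=
  exists s : seq M, forall v,
    N v <-> exists c : nat -> k, v = \sum_(i < size s) c i *: s`_i.

Definition simple g N : Prop :=
  [/\ submodule g N, exists2 v, N v & v != 0
    & forall L, submodule g L -> (forall v, L v -> N v) ->
        (forall v, L v -> v = 0) \/ (forall v, N v -> L v)].

(* M is the internal direct sum of the subspaces N j, j : J. *)
Definition direct_sum (J : Type) (N : J -> M -> Prop) : Prop :=
  (forall v : M, exists (m : nat) (j : 'I_m -> J) (x : 'I_m -> M),
     (forall a, N (j a) (x a)) /\ v = \sum_a x a) /\
  (forall (m : nat) (j : 'I_m -> J) (x : 'I_m -> M),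
     injective j -> (forall a, N (j a) (x a)) ->
     \sum_a x a = 0 -> forall a, x a = 0).

(* The weight with coordinates beta is sum_i beta_i eps_i, that is
   H |-> sum_i beta_i H_(i,i); every linear form on the Cartan subalgebra is
   of this form. *)
Definition weight_space (beta : idx n -> k) : M -> Prop :=
  fun v => forall H : gl k n, cartan H ->
    act H v = (\sum_(p <- msupp H) beta p.1 * H@_p) *: v.

(* For finite n this is finite-dimensionality.  For n = oo it is
   finite-dimensionality rank by rank (local finiteness over the Levi
   subalgebras of gl_m, m finite), which for simple modules of finite rank is
   the same thing.  Plain finite-dimensionality is not usable for n = oo: the
   only finite-dimensional simple modules over gl_1 (+) gl_oo have dimension
   1, so the natural module k^(oo), which is in P_1, would be excluded from
   O^p. *)
Definition levi_finite N : Prop :=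
  if n is Some _ then fin_dim N
  else forall (m : nat) v, N v -> fin_dim (generated (levi_upto m) (eq v)).

End Modules.

Section Categories.
Variables (k : fieldType) (n : option nat).

(* Subcategories of the category of U(gl_n)-modules. *)
Record subcat := SubCat {
  ob : glmod k n -> Prop;
  hom : forall M N : glmod k n, (M -> N) -> Prop }.

Definition gl_hom (M N : glmod k n) (f : M -> N) : Prop :=
  linear f /\ forall A v, f (act A v) = act A (f v).

Definition full_on (P : glmod k n -> Prop) : subcat := SubCat P gl_hom.

Definition full_subcategory (C D : subcat) : Prop :=
  (forall M, ob C M -> ob D M) /\
  (forall M N, ob C M -> ob C N ->
     forall f : M -> N, hom C f <-> hom D f).

Definition P1 (M : glmod k n) : Prop := fin_gen M (@gl_all k n).

Definition P2 (M : glmod k n) : Prop :=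
  exists (J : Type) (N : J -> M -> Prop),
    (forall j, simple (@levi k n) (N j) /\ levi_finite (N j)) /\
    direct_sum N.

Definition P3 (M : glmod k n) : Prop :=
  forall v : M, fin_dim (generated (@nil_plus k n) (eq v)).

Definition category_Op : subcat := full_on (fun M => [/\ P1 M, P2 M & P3 M]).

Definition Lambda (t : k) (beta : idx n -> k) : Prop :=
  [/\ forall i : idx n, val i = 1%N -> exists z : int, beta i = t - z%:~R,
      forall i : idx n, (2 <= val i)%N -> exists m : nat, beta i = m%:R
    & exists s : seq (idx n),
        [/\ uniq s, forall i, i \notin s -> beta i = 0
          & \sum_(i <- s) beta i = t]].

Definition category_P (t : k) : subcat :=
  full_on (fun M =>
    [/\ fin_gen M (@gl_all k n), direct_sum (@weight_space k n M)
      & forall beta, (exists2 v : M, weight_space beta v & v != 0) ->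
          Lambda t beta]).

End Categories.

(* Main.v *)
(* Let gl_I, with I the indices i >= 2, act on a module whose weights are
   natural numbers with finite support.  The normally ordered Casimir operator
   sum_(i,j) E_ij E_ji - |A| sum_i E_ii, with sums over a finite set A of
   indices, does not depend on A once A is large enough on a given vector, also
   when I is infinite; it commutes with gl_I and takes different values on
   comparable dominant weights.  Hence highest weight vectors generate simple
   modules, and a vector that is highest modulo the sum of these simple modules
   can be corrected into a highest weight vector, so that the sum is
   everything.  Zorn's lemma extracts a direct sum.  Local finiteness holds
   because raising and lowering operators with finitely many indices change a
   natural number attached to the weight monotonically. *)

From HB Require Import structures.
Require Import Defs.
From mathcomp Require Import boolp classical_sets.
From mathcomp Require Import ring.

Set Implicit Arguments.
Unset Strict Implicit.
Unset Printing Implicit Defensive.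

Import GRing.Theory.

(** The obstacle is n = oo: the restriction to the Levi subalgebra need not be a sum of
    finite-dimensional modules, so Weyl's theorem does not give P2. The argument is run instead for
    abstract operators [e i j] with the relations of matrix units, on an index set ordered by an
    injective rank, together with an operator [z] commuting with them; [z] stands for E_(1,1), the
    gl_1 factor. One observation underlies the finiteness of all sums: for i <> j, [e i j] subtracts
    1 from coordinate [j] of a weight, so it kills a weight vector whose coordinate [j] is 0.
    Complete reducibility needs no classification of central characters: a vector that is highest
    modulo the sum of the simple modules is only confronted with weights strictly above its own, and
    strict inequality of weights already separates Casimir values. *)

Section NaturalScalars.
Local Open Scope ring_scope.
Variable k : fieldType.
Hypothesis k0 : [pchar k] =i pred0.
Implicit Types x y : k.

(** The field carries no order; being the image of a natural number, or of a positive one, replaces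
    the inequalities >= 0 and > 0. *)
Definition natk x : Prop := exists m : nat, x = m%:R.
Definition posk x : Prop := exists m : nat, x = m.+1%:R.

Lemma natr0P m : (m%:R == 0 :> k) = (m == 0)%N.
Proof. by have /pcharf0P -> := k0. Qed.

Lemma natr_injective : injective (fun m : nat => m%:R : k).
Proof.
move=> a b; wlog ab : a b / (a <= b)%N => [H|] eqab.
  by case/orP: (leq_total a b) => ab; [apply: H|symmetry; apply: H].
apply/eqP; rewrite eqn_leq ab -subn_eq0 -natr0P natrB //=.
by rewrite eqab subrr.
Qed.

Lemma posk_neq0 x : posk x -> x != 0.
Proof. by case=> m ->; rewrite natr0P. Qed.

Lemma natk0 : natk 0. Proof. by exists 0%N. Qed.

Lemma natkD x y : natk x -> natk y -> natk (x + y).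
Proof. by move=> [a ->] [b ->]; exists (a + b)%N; rewrite natrD. Qed.

Lemma natkM x y : natk x -> natk y -> natk (x * y).
Proof. by move=> [a ->] [b ->]; exists (a * b)%N; rewrite natrM. Qed.

Lemma natk_posk x : posk x -> natk x.
Proof. by case=> m ->; exists m.+1. Qed.

Lemma poskD x y : natk x -> posk y -> posk (x + y).
Proof. by move=> [a ->] [b ->]; exists (a + b)%N; rewrite -natrD addnS. Qed.

Lemma posk_subn (a b : nat) : posk (a%:R - b%:R) -> (b < a)%N.
Proof.
case=> m /eqP; rewrite subr_eq -natrD => /eqP /natr_injective ->.
by rewrite addSn ltnS leq_addl.
Qed.

Lemma natkB_posk (a b : nat) : (b < a)%N -> posk (a%:R - b%:R).
Proof.
by move=> ba; exists (a - b).-1; rewrite prednK ?subn_gt0 // natrB // ltnW.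
Qed.

Lemma natk_sum (T : eqType) (s : seq T) (F : T -> k) :
  (forall i, i \in s -> natk (F i)) -> natk (\sum_(i <- s) F i).
Proof.
move=> H; rewrite big_seq; elim/big_ind: _ => //; [exact: natk0|exact: natkD].
Qed.

Lemma sum_delta (T : eqType) (s : seq T) (a : T) (F : T -> k) : uniq s ->
  \sum_(i <- s) (i == a)%:R * F i = (a \in s)%:R * F a.
Proof.
move=> us; case: (boolP (a \in s)) => [sa|nsa].
  rewrite (bigD1_seq a) //= eqxx big1 ?addr0 // => i /negbTE ->.
  by rewrite mul0r.
rewrite mul0r big1_seq // => i /= si; case: eqP => [ia|]; last by rewrite mul0r.
by rewrite -ia si in nsa.
Qed.

Lemma sum_deltaZ (V : lmodType k) (T : eqType) (s : seq T) (a : T)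
    (F : T -> V) : uniq s -> a \in s ->
  \sum_(i <- s) (i == a)%:R *: F i = F a.
Proof.
move=> us sa; rewrite (bigD1_seq a) //= eqxx scale1r big1 ?addr0 //.
by move=> i /negbTE ->; rewrite scale0r.
Qed.

End NaturalScalars.

(** * Sums of vectors taken from a set, and joint eigenvectors of a family of operators *)

Section Sums.
Local Open Scope ring_scope.
Variables (k : fieldType) (M : lmodType k).
Implicit Types (B N : M -> Prop) (u v x y : M).

Definition fsum B x : Prop :=
  exists s : seq M, (forall u, u \in s -> B u) /\ x = \sum_(u <- s) u.

Definition subspace N : Prop :=
  N 0 /\ forall (a : k) u v, N u -> N v -> N (a *: u + v).

Definition scale_closed B : Prop := forall (a : k) u, B u -> B (a *: u).

Lemma subspaceD N u v : subspace N -> N u -> N v -> N (u + v).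
Proof. by case=> _ H /H{}H /H; rewrite -[u in _ -> N (u + _)]scale1r. Qed.

Lemma subspaceZ N a u : subspace N -> N u -> N (a *: u).
Proof. by case=> N0 H Nu; rewrite -[_ *: _]addr0; apply: H. Qed.

Lemma subspaceB N u v : subspace N -> N u -> N v -> N (u - v).
Proof.
by move=> sN Nu Nv; rewrite -scaleN1r; apply: subspaceD => //; apply: subspaceZ.
Qed.

Lemma subspace_sum N (T : eqType) (s : seq T) (F : T -> M) :
  subspace N -> (forall i, i \in s -> N (F i)) -> N (\sum_(i <- s) F i).
Proof.
move=> sN H; rewrite big_seq; elim/big_ind: _ => //; first by case: sN.
by move=> *; apply: subspaceD.
Qed.

Lemma fsum1 B u : B u -> fsum B u.
Proof.
by move=> Bu; exists [:: u]; rewrite big_seq1; split=> // v; rewrite inE => /eqP->.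
Qed.

Lemma fsum0 B : fsum B 0.
Proof. by exists [::]; rewrite big_nil. Qed.

Lemma fsumD B x y : fsum B x -> fsum B y -> fsum B (x + y).
Proof.
move=> [s [Bs ->]] [s' [Bs' ->]]; exists (s ++ s'); rewrite big_cat; split=> // u.
by rewrite mem_cat => /orP[/Bs|/Bs'].
Qed.

Lemma fsum_ind B N : N 0 -> (forall u v, N u -> N v -> N (u + v)) ->
  (forall u, B u -> N u) -> forall x, fsum B x -> N x.
Proof.
move=> N0 ND BN x [s [Bs ->]]; rewrite big_seq; elim/big_ind: _ => // u /Bs.
exact: BN.
Qed.

Lemma fsum_min B N x : subspace N -> (forall u, B u -> N u) -> fsum B x -> N x.
Proof.
move=> sN BN; apply: fsum_ind => //; first by case: sN.
by move=> *; apply: subspaceD.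
Qed.

Lemma fsum_map B B' (f : {linear M -> M}) x :
  (forall u, B u -> fsum B' (f u)) -> fsum B x -> fsum B' (f x).
Proof.
move=> H; apply: (fsum_ind (N := fun x => fsum B' (f x))) => //.
  by rewrite raddf0; apply: fsum0.
by move=> u v Bu Bv; rewrite raddfD; apply: fsumD.
Qed.

Lemma fsum_sub B B' x : (forall u, B u -> B' u) -> fsum B x -> fsum B' x.
Proof. by move=> H [s [Bs ->]]; exists s; split=> // u /Bs /H. Qed.

Lemma fsum_subspace B : scale_closed B -> subspace (fsum B).
Proof.
move=> cB; split=> [|a u v Bu Bv]; first exact: fsum0.
apply: fsumD => //; apply: (fsum_map (f := *:%R a)) Bu => w Bw.
by apply: fsum1; apply: cB.
Qed.

Lemma add_scale_false (x y : M) : x + false%:R *: y = x.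
Proof. by rewrite scale0r addr0. Qed.

Lemma sub_scale_false (x y : M) : x - false%:R *: y = x.
Proof. by rewrite scale0r subr0. Qed.

Lemma scale_bool (b : bool) (x y : M) : (b -> x = y) -> b%:R *: x = b%:R *: y.
Proof. by case: b => [->|_] //; rewrite !scale0r. Qed.

Section Eigen.
Variables (X : Type) (T : X -> {linear M -> M}).

Definition eigen (chi : X -> k) u : Prop := forall o, T o u = chi o *: u.

Lemma eigenZ chi a u : eigen chi u -> eigen chi (a *: u).
Proof. by move=> eu o; rewrite linearZ_LR eu !scalerA mulrC. Qed.

Lemma eigen_subspace chi : subspace (eigen chi).
Proof.
split=> [o|a u v eu ev o]; first by rewrite raddf0 scaler0.
by rewrite linearPZ eu ev scalerDr !scalerA mulrC.
Qed.

(** [T o - chi1 o] kills the first summand, rescales the others and multiplies [y] by the nonzero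
    scalar [chi o - chi1 o]; induction on the number of summands. *)
Lemma eigen_sum_eq0 chi y : eigen chi y ->
  fsum (fun u => exists2 chi', eigen chi' u & exists o, chi' o != chi o) y ->
  y = 0.
Proof.
move=> ey [s [Bs ys]]; have [n sn] := ubnP (size s).
elim: n => // n IHn in s y ey Bs ys sn *.
case: s Bs ys sn => [_ ->|u1 s Bs ys sn]; first by rewrite big_nil.
have [chi1 e1 [o ne_o]] := Bs u1 (mem_head _ _).
suff /eqP: (chi o - chi1 o) *: y = 0.
  by rewrite scaler_eq0 subr_eq0 eq_sym (negPf ne_o) => /eqP.
apply: (IHn [seq T o u - chi1 o *: u | u <- s]); first exact: eigenZ.
- move=> _ /mapP[u su ->].
  have [chi2 e2 ne2] := Bs u (@mem_behead _ (u1 :: s) u su).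
  by exists chi2 => //; rewrite e2 -scalerBl; apply: eigenZ.
- rewrite scalerBl -ey ys big_cons (linearD (T o)) scalerDr e1 opprD addrACA subrr add0r.
  by rewrite big_map big_split /= sumrN (linear_sum (T o)) scaler_sumr.
- by rewrite size_map.
Qed.

Lemma eigen_component (B : M -> Prop) chi y :
  (forall u, B u -> exists chi', eigen chi' u) ->
  eigen chi y -> fsum B y -> fsum (fun u => B u /\ eigen chi u) y.
Proof.
move=> eB ey [s [Bs ys]].
exists [seq u <- s | `[< eigen chi u >]]; split.
  by move=> u; rewrite mem_filter => /andP[/asboolP eu /Bs].
apply/eqP; rewrite big_filter -subr_eq0; apply/eqP.
apply: (@eigen_sum_eq0 chi).
  rewrite -big_filter; apply: (subspaceB (eigen_subspace chi)) => //.
  apply: subspace_sum; first exact: eigen_subspace.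
  by move=> u; rewrite mem_filter => /andP[/asboolP].
exists [seq u <- s | ~~ `[< eigen chi u >]]; split; last first.
  by rewrite big_filter ys (bigID (fun u => `[< eigen chi u >])) /= addrAC subrr add0r.
move=> u; rewrite mem_filter => /andP[/asboolP neu /Bs /eB[chi' eu]].
exists chi' => //; apply: contrapT => /forallNP H; apply: neu => o.
by rewrite eu; have /negP/negPn/eqP -> := H o.
Qed.

Lemma eigen_uniq chi chi' u : eigen chi u -> eigen chi' u -> u != 0 -> chi = chi'.
Proof.
move=> eu eu' un0; apply: funext => o; apply/eqP.
have /eqP : (chi o - chi' o) *: u = 0 by rewrite scalerBl -eu -eu' subrr.
by rewrite scaler_eq0 (negPf un0) orbF subr_eq0.
Qed.

(** If [x] is not itself an eigenvector with the character [chi1] of its first summand, then some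
    [T o x - chi1 o *: x] is a nonzero element of [N] with fewer summands. *)
Lemma eigen_in_subspace N x : subspace N -> (forall o u, N u -> N (T o u)) ->
  fsum (fun u => exists chi, eigen chi u) x -> N x -> x != 0 ->
  exists chi u, [/\ eigen chi u, u != 0 & N u].
Proof.
move=> sN TN [s [es xs]] Nx xn0; have [n sn] := ubnP (size s).
elim: n => // n IHn in s x es xs Nx xn0 sn *.
case: s es xs sn => [_ x0|u1 s es xs sn]; first by rewrite x0 big_nil eqxx in xn0.
have [chi1 e1] := es u1 (mem_head _ _).
have [H|/existsNP[o no]] := pselect (eigen chi1 x); first by exists chi1, x.
apply: (IHn [seq T o u - chi1 o *: u | u <- s] (T o x - chi1 o *: x)).
- move=> _ /mapP[u su ->].
  have [chi2 e2] := es u (@mem_behead _ (u1 :: s) u su).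
  by exists chi2; rewrite e2 -scalerBl; apply: eigenZ.
- rewrite xs big_cons (linearD (T o)) scalerDr e1 opprD addrACA subrr add0r.
  by rewrite big_map big_split /= sumrN (linear_sum (T o)) scaler_sumr.
- by apply: subspaceB => //; [apply: TN|apply: subspaceZ].
- by rewrite subr_eq0; apply/eqP.
- by rewrite size_map.
Qed.

End Eigen.
End Sums.

(** * Finite spans, and words in operators applied to a vector *)

Section FiniteSpan.
Local Open Scope ring_scope.
Variables (k : fieldType) (M : lmodType k).
Implicit Types (N : M -> Prop) (u v x y : M) (s : seq M).

Definition lspan s x : Prop :=
  exists c : nat -> k, x = \sum_(i < size s) c i *: s`_i.

Lemma lspan_nil x : lspan [::] x <-> x = 0.
Proof.
by split=> [[c ->]|->]; [rewrite big_ord0|exists (fun _ => 0); rewrite big_ord0].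
Qed.

Lemma lspan_cons y s x :
  lspan (y :: s) x <-> exists a x', lspan s x' /\ x = a *: y + x'.
Proof.
split=> [[c ->]|[a [_ [[c ->] ->]]]].
  rewrite big_ord_recl /=; exists (c 0%N), (\sum_(i < size s) c i.+1 *: s`_i).
  by split=> //; exists (fun i => c i.+1).
by exists (fun i => if i is j.+1 then c j else a); rewrite big_ord_recl.
Qed.

Lemma lspan_subspace s : subspace (lspan s).
Proof.
split=> [|a u v [c ->] [d ->]].
  by exists (fun _ => 0); rewrite big1 // => i _; rewrite scale0r.
exists (fun i => a * c i + d i); rewrite scaler_sumr -big_split.
by apply: eq_bigr => i _; rewrite /= scalerDl scalerA.
Qed.

Lemma lspan_mem s u : u \in s -> lspan s u.
Proof.
elim: s => // y s IHs; rewrite inE => su; apply/lspan_cons.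
case/orP: su => [/eqP->|/IHs Hu].
  by exists 1, 0; rewrite scale1r addr0; split=> //; case: (lspan_subspace s).
by exists 0, u; rewrite scale0r add0r.
Qed.

(** Induction on the spanning list: [N] is spanned by its intersection with the span of the tail and
    at most one further vector, one whose coefficient along the head is nonzero. *)
Lemma subspace_lspan N s : subspace N -> (forall x, N x -> lspan s x) ->
  exists s', forall x, N x <-> lspan s' x.
Proof.
elim: s N => [|y s IHs] N sN Ns.
  exists [::] => x; split; first exact: Ns.
  by move/lspan_nil->; case: sN.
have [||s' Hs'] := IHs (fun x => N x /\ lspan s x); first last.
- have [Ns1|/existsNP[x0 /not_implyP[Nx0 nx0]]] := pselect (forall x, N x -> lspan s x).
    by exists s' => x; rewrite -Hs'; split=> [Nx|[]//]; split=> //; apply: Ns1.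
  have [a0 [x0' [sx0' x0E]]] := (lspan_cons y s x0).1 (Ns _ Nx0).
  have a0n0 : a0 != 0.
    by apply/eqP=> a00; apply: nx0; rewrite x0E a00 scale0r add0r.
  exists (x0 :: s') => x; split=> [Nx|/lspan_cons[a [x' [/Hs'[Nx' _] ->]]]].
    have [a [x' [sx' xE]]] := (lspan_cons y s x).1 (Ns _ Nx).
    apply/lspan_cons; exists (a / a0), (x - (a / a0) *: x0).
    rewrite subrKC; split=> //; apply/Hs'; split.
      by apply: subspaceB => //; apply: subspaceZ.
    rewrite xE x0E scalerDr scalerA divfK // opprD addrACA subrr add0r.
    have sS := lspan_subspace s.
    by apply: subspaceB => //; apply: subspaceZ.
  by apply: subspaceD => //; apply: subspaceZ.
- by move=> x [].
- split=> [|a u v [Nu su] [Nv sv]]; first by case: sN => N0; case: (lspan_subspace s).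
  by split; [case: sN => _; apply|case: (lspan_subspace s) => _; apply].
Qed.

Lemma lspan_min (N : M -> Prop) (s : seq M) x : subspace N ->
  (forall u, u \in s -> N u) -> lspan s x -> N x.
Proof.
move=> sN Ns [c ->]; apply: (subspace_sum sN) => i _.
by apply: (subspaceZ _ sN); apply: Ns; rewrite mem_nth.
Qed.

Lemma lspan_catl (s s' : seq M) x : lspan s x -> lspan (s ++ s') x.
Proof.
apply: lspan_min => [|u us]; first exact: lspan_subspace.
by apply: lspan_mem; rewrite mem_cat us.
Qed.

Lemma lspan_catr (s s' : seq M) x : lspan s' x -> lspan (s ++ s') x.
Proof.
apply: lspan_min => [|u us]; first exact: lspan_subspace.
by apply: lspan_mem; rewrite mem_cat us orbT.
Qed.

Section Words.
Variables (X : eqType) (T : X -> {linear M -> M}).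

Definition word (w : seq X) v : M := foldr (fun p y => T p y) v w.

Lemma bounded_words_lspan (l : seq X) v (b : nat) :
  (forall w, all (mem l) w -> word w v != 0 -> (size w <= b)%N) ->
  exists s, forall w, all (mem l) w -> lspan s (word w v).
Proof.
move=> Hb; pose ws := fix ws n := if n is m.+1
  then v :: [seq T p y | p <- l, y <- ws m] else [:: v].
have wsP n w : all (mem l) w -> (size w <= n)%N -> word w v \in ws n.
  elim: n w => [|n IHn] [|p w] //=; rewrite ?inE ?eqxx //.
  move=> /andP[lp lw] sw; apply/orP; right; apply/allpairsP.
  by exists (p, word w v); split=> //; apply: IHn.
exists (ws b) => w lw; have [->|/(Hb _ lw) sw] := eqVneq (word w v) 0.
  by case: (lspan_subspace (ws b)).
by apply: lspan_mem; apply: wsP.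
Qed.

(* The weight q decreases along words and is a natural number on the words
   that do not kill v, so that only finitely many words survive. *)
Lemma decreasing_words_lspan (l : seq X) v (q : seq X -> k) :
  [pchar k] =i pred0 ->
  (forall w, all (mem l) w -> word w v != 0 -> natk (q w)) ->
  (forall p w, p \in l -> posk (q w - q (p :: w))) ->
  exists s, forall w, all (mem l) w -> lspan s (word w v).
Proof.
move=> k0 qnat qlt; have [v0|vn0] := eqVneq v 0.
  exists [::] => w _; have -> : word w v = 0; last by apply/lspan_nil.
  by rewrite v0; elim: w => //= p w ->; rewrite raddf0.
have [b qb] := qnat [::] isT vn0.
apply: (@bounded_words_lspan l v b) => w lw wn0.
(* Each letter lowers [q] by at least 1, so the length of [w] is at most the total drop [d]; as
   [q w] is a natural number, [d] is at most [b], the value on the empty word. *)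
have [d qd wd] : exists2 d, q [::] - q w = d%:R & (size w <= d)%N.
  elim: w lw {wn0} => [|p w IHw] /=; first by exists 0%N; rewrite ?subrr.
  move=> /andP[lp /IHw[d qd wd]]; have [m qm] := qlt p w lp.
  exists (d + m.+1)%N; last by rewrite addnS ltnS (leq_trans wd) ?leq_addr.
  by rewrite natrD -qd -qm addrA subrK.
have [n qn] := qnat w lw wn0.
move/eqP: qd; rewrite qb qn subr_eq -natrD => /eqP /(natr_injective k0) ->.
exact: leq_trans wd (leq_addr _ _).
Qed.

End Words.
End FiniteSpan.

(** * Modules over gl_I with natural number weights, for an index set I ordered by an injective
    rank *)

Section PolynomialModule.
Local Open Scope ring_scope.
Variables (k : fieldType) (I : choiceType) (rk : I -> nat) (M : lmodType k).
Variables (e : I -> I -> {linear M -> M}) (z : {linear M -> M}).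
Hypothesis k0 : [pchar k] =i pred0.
Hypothesis rk_inj : injective rk.
Hypothesis e_comm : forall i j a b x, e i j (e a b x) =
  e a b (e i j x) + (j == a)%:R *: e i b x - (b == i)%:R *: e a j x.
Hypothesis z_comm : forall i j x, z (e i j x) = e i j (z x).
Implicit Types (i j a b : I) (u v x y : M) (chi mu lam : option I -> k).
Implicit Types (A B : seq I) (S N : M -> Prop) (w : seq (I * I)).

(* Weights are indexed by option I: Some i for the eigenvalue of e i i, None
   for that of z. *)
Definition torus (o : option I) : {linear M -> M} :=
  if o is Some i then e i i else z.

Definition wvec := eigen torus.

Definition addroot i j chi : option I -> k :=
  fun o => chi o + ((o == Some i)%:R - (o == Some j)%:R).

Lemma wvec_e chi u i j : wvec chi u -> wvec (addroot i j chi) (e i j u).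
Proof.
move=> wu [a|] /=; last first.
  rewrite z_comm; have -> : z u = chi None *: u := wu None.
  by rewrite linearZZ /addroot subr0 addr0.
rewrite e_comm; have -> : e a a u = chi (Some a) *: u := wu (Some a).
rewrite linearZZ /addroot !(inj_eq Some_inj) scalerDl scalerBl addrA (eq_sym j a).
by case: (eqVneq a i) => [<-|_]; case: (eqVneq a j) => [<-|_];
  rewrite ?scale0r ?addr0.
Qed.

Definition ew (p : I * I) := e p.1 p.2.
Definition wshift w chi := foldr (fun p c => addroot p.1 p.2 c) chi w.

Lemma wvec_word chi v w : wvec chi v -> wvec (wshift w chi) (word ew w v).
Proof. by move=> wv; elim: w => //= p w IHw; apply: wvec_e. Qed.

Definition stable N := [/\ subspace N, forall i j x, N x -> N (e i j x)
  & forall x, N x -> N (z x)].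

Lemma stable_word N w v : stable N -> N v -> N (word ew w v).
Proof. by move=> [_ He _] Nv; elim: w => //= p w; apply: He. Qed.

Definition gen v x := forall N, stable N -> N v -> N x.

Lemma gen_stable v : stable (gen v).
Proof.
split=> [|i j x Gx N sN Nv|x Gx N sN Nv].
- split=> [N [[N0 _] _ _] //|a x y Gx Gy N sN Nv].
  by have [[_ H] _ _] := sN; apply: H (Gx _ sN Nv) (Gy _ sN Nv).
- by have [_ H _] := sN; apply: H (Gx _ sN Nv).
- by have [_ _ H] := sN; apply: H (Gx _ sN Nv).
Qed.

Lemma gen_id v : gen v v. Proof. by []. Qed.

(** * Highest weight vectors *)

Definition hwvec chi v := wvec chi v /\ forall i j, (rk i < rk j)%N -> e i j v = 0.

(** [P] restricts the indices: [predT] serves for the whole cyclic module, membership in a finite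
    list for local finiteness. *)
Definition lowering (P : pred I) (p : I * I) :=
  [&& (rk p.2 < rk p.1)%N, P p.1 & P p.2].

Definition lowered (P : pred I) v x := exists (c : k) w,
  all (lowering P) w /\ x = c *: word ew w v.

Lemma lowered_scale P v : scale_closed (lowered P v).
Proof. by move=> a _ [c [w [Pw ->]]]; exists (a * c), w; rewrite scalerA. Qed.

Lemma lowered_subspace P v : subspace (fsum (lowered P v)).
Proof. exact/fsum_subspace/lowered_scale. Qed.

Lemma lowered_word P v w : all (lowering P) w ->
  fsum (lowered P v) (word ew w v).
Proof. by move=> Pw; apply: fsum1; exists 1, w; rewrite scale1r. Qed.

Lemma lowered_torus P chi v o x : wvec chi v ->
  fsum (lowered P v) x -> fsum (lowered P v) (torus o x).
Proof.
move=> wv; apply: fsum_map => _ [c [w [Pw ->]]].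
rewrite linearZZ (wvec_word w wv) scalerA; apply: fsum1.
by exists (c * wshift w chi o), w.
Qed.

(* The triangular decomposition: moving e i j to the right through a word of
   lowering operators only produces words of lowering operators. *)
Lemma lowered_e (P : pred I) chi v i j x : hwvec chi v -> P i -> P j ->
  fsum (lowered P v) x -> fsum (lowered P v) (e i j x).
Proof.
move=> [wv hv] Pi Pj; apply: fsum_map => _ [c [w [Pw ->]]].
have sL := lowered_subspace P v.
rewrite linearZZ; apply: subspaceZ => //.
elim: w Pw i j Pi Pj => [_|[a b] w IHw /= /andP[Pab Pw]] i j Pi Pj.
  case: (ltngtP (rk i) (rk j)) => [ij|ji|/rk_inj <-].
  - by rewrite /= hv //; apply: fsum0.
  - by apply: (@lowered_word P v [:: (i, j)]); rewrite /= /lowering ji Pi Pj.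
  - by apply: (lowered_torus (Some i) wv); apply: (@lowered_word P v [::]).
have [_ /= Pa Pb] := and3P Pab.
rewrite /ew /= e_comm; apply: subspaceB => //; last by apply: subspaceZ => //; apply: IHw.
apply: subspaceD => //; last by apply: subspaceZ => //; apply: IHw.
apply: (fsum_map (B := lowered P v)) (IHw Pw _ _ Pi Pj) => _ [d [w' [Pw' ->]]].
apply: fsum1; rewrite linearZZ; exists d, ((a, b) :: w'); split=> //=.
by rewrite Pab.
Qed.

Lemma gen_lowered chi v x : hwvec chi v -> gen v x -> fsum (lowered predT v) x.
Proof.
move=> hv Gx; apply: (Gx (fsum (lowered predT v))); last exact: (@lowered_word _ v [::]).
split; first exact: lowered_subspace.
  by move=> i j y; apply: (lowered_e hv).
by move=> y; apply: (lowered_torus None hv.1).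
Qed.

(** The strict dominance order in dual form: [lam - mu] pairs positively with every strictly
    decreasing [G], on all large enough finite sets of indices. The Casimir comparison needs exactly
    this pairing. *)
Definition wlt mu lam := exists A0, forall A, uniq A -> {subset A0 <= A} ->
  forall G : I -> k,
  (forall i j, i \in A -> j \in A -> (rk i < rk j)%N -> posk (G i - G j)) ->
  posk (\sum_(i <- A) (lam (Some i) - mu (Some i)) * G i).

Lemma wlt_trans mu lam chi : wlt mu lam -> wlt lam chi -> wlt mu chi.
Proof.
move=> [A H] [A' H']; exists (A ++ A') => B uB sB G HG.
have sA : {subset A <= B} by move=> i iA; apply: sB; rewrite mem_cat iA.
have sA' : {subset A' <= B} by move=> i iA; apply: sB; rewrite mem_cat iA orbT.
have := poskD (natk_posk (H B uB sA G HG)) (H' B uB sA' G HG).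
by rewrite -big_split /=; congr posk; apply: eq_bigr => i _; ring.
Qed.

Lemma wlt_diff i j mu lam : (rk i < rk j)%N ->
  (forall a, lam (Some a) - mu (Some a) = (a == i)%:R - (a == j)%:R) ->
  wlt mu lam.
Proof.
move=> ij H; exists [:: i; j] => A uA sA G HG.
have iA : i \in A by apply: sA; rewrite inE eqxx.
have jA : j \in A by apply: sA; rewrite !inE eqxx orbT.
under eq_bigr do rewrite H mulrBl.
by rewrite sumrB !sum_delta // iA jA !mul1r; apply: HG.
Qed.

Lemma wlt_raise i j chi : (rk i < rk j)%N -> wlt chi (addroot i j chi).
Proof.
by move=> ij; apply: (wlt_diff ij) => a; rewrite /addroot !(inj_eq Some_inj); ring.
Qed.

Lemma wlt_lower i j chi : (rk j < rk i)%N -> wlt (addroot i j chi) chi.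
Proof.
by move=> ji; apply: (wlt_diff ji) => a; rewrite /addroot !(inj_eq Some_inj); ring.
Qed.

Lemma wlt_wshift (P : pred I) chi w : all (lowering P) w ->
  w = [::] \/ wlt (wshift w chi) chi.
Proof.
elim: w => [|p w IHw] /=; first by left.
move=> /andP[/and3P[lp _ _] /IHw{}IHw]; right.
have lt1 := wlt_lower (wshift w chi) lp.
by case: IHw => [w0|]; [rewrite w0 in lt1 *|apply: (wlt_trans lt1)].
Qed.

(** * The Casimir operator *)

Definition dominant chi :=
  forall i j, (rk i < rk j)%N -> natk (chi (Some i) - chi (Some j)).

(** For [i] in a duplicate-free [A] this is -(2 m + 1), with m the number of indices of [A] below
    [i]: the sum of the positive roots of gl_A, shifted by the -|A| of the normally ordered Casimir
    operator. The shift makes it independent of the indices above [i]. *)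
Definition rho A i : k :=
  - \sum_(l <- A) ((rk l < rk i)%N%:R + (rk l <= rk i)%N%:R).

Definition casval A chi : k :=
  \sum_(i <- A) chi (Some i) * (chi (Some i) + rho A i).

Lemma posk_rho A i j : uniq A -> j \in A -> (rk i < rk j)%N ->
  posk (rho A i - rho A j).
Proof.
move=> uA jA ij; rewrite /rho opprK addrC -sumrB (bigD1_seq j) //=.
rewrite ltnn leqnn (leqNgt (rk j)) ij (ltnNge (rk j)) (ltnW ij) /= addrC.
apply: poskD; last by exists 0%N; rewrite !mulr0n add0r addr0 subr0.
rewrite -big_filter; apply: natk_sum => l _.
have [li|il] := ltnP (rk l) (rk i).
  by rewrite (ltnW li) (ltn_trans li ij) (ltnW (ltn_trans li ij)) subrr; apply: natk0.
rewrite mulr0n add0r; have [li|il'] := leqP (rk l) (rk i).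
  rewrite (leq_ltn_trans li ij) (ltnW (leq_ltn_trans li ij)) addrK.
  by exists 1%N.
by rewrite mulr0n subr0; apply: natkD; exact: (ex_intro _ (nat_of_bool _)).
Qed.

(** The difference is the sum of [(lam - mu) * (lam + mu + rho)], and the second factor is strictly
    decreasing because both weights are dominant and [rho] is strictly decreasing. *)
Lemma casval_lt mu lam : dominant mu -> dominant lam -> wlt mu lam ->
  exists A0, forall A, uniq A -> {subset A0 <= A} ->
  posk (casval A lam - casval A mu).
Proof.
move=> dmu dlam [A0 H]; exists A0 => A uA sA.
have := H A uA sA (fun i => lam (Some i) + mu (Some i) + rho A i).
rewrite /casval -sumrB => Hp.
under eq_bigr => i _.
  rewrite (_ : _ - _ = (lam (Some i) - mu (Some i)) *
    (lam (Some i) + mu (Some i) + rho A i)); last by ring.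
  over.
apply: Hp => i j iA jA ij.
have := poskD (natkD (dlam _ _ ij) (dmu _ _ ij)) (posk_rho uA jA ij).
by congr posk; ring.
Qed.

Definition covers A u := forall i j, j \notin A -> e i j u = 0.

Definition omega A x : M := \sum_(i <- A) \sum_(j <- A) e i j (e j i x)
  - (size A)%:R *: \sum_(i <- A) e i i x.

Lemma omega_perm A B x : perm_eq A B -> omega A x = omega B x.
Proof.
move=> pAB; rewrite /omega (perm_size pAB) !(perm_big _ pAB) /=; congr (_ - _).
by apply: eq_bigr => i _; rewrite (perm_big _ pAB).
Qed.

(** For [j] outside [A] and [i] in [A], [e i j (e j i u)] reduces to [e i i u], since [e i j] and
    [e j j] kill [u]. Each new index thus adds one copy of the sum of the [e i i u], which the
    growth of the factor [size A] cancels. *)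
Lemma omega_stable A B u : uniq A -> uniq B -> {subset A <= B} -> covers A u ->
  omega B u = omega A u.
Proof.
move=> uA uB sAB cA; set D := [seq i <- B | i \notin A].
have nD i : i \in D -> i \notin A by rewrite mem_filter => /andP[].
have pB : perm_eq B (A ++ D).
  apply: uniq_perm => //.
    rewrite cat_uniq uA filter_uniq // andbT; apply/hasPn => i /nD.
    by [].
  move=> i; rewrite mem_cat mem_filter; case: (boolP (i \in A)) => // /sAB ->.
  by [].
rewrite (omega_perm _ pB) /omega size_cat !big_cat /=.
rewrite [X in _ + X - _]big1_seq ?addr0; last first.
  move=> i /= /nD iA; apply: big1 => j _; by rewrite cA // raddf0.
rewrite [X in _ *: (_ + X)]big1_seq ?addr0; last by move=> i /= /nD iA; rewrite cA.
under eq_bigr => i _.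
  rewrite big_cat /= [X in _ + X](eq_big_seq (fun=> e i i u)); last first.
    move=> j /nD jA; rewrite e_comm !eqxx !scale1r !(cA _ _ jA).
    by rewrite raddf0 add0r subr0.
  rewrite big_const_seq count_predT iter_addr_0; over.
rewrite big_split /= -addrA; congr (_ + _).
by rewrite natrD scalerDl sumrMnl opprD addrCA -scaler_nat subrr addr0.
Qed.

(** [F i j] collects the four commutator terms. As [a] and [b] lie in [A], every Kronecker delta
    collapses its double sum to a single one, and these cancel in pairs. *)
Lemma omega_comm A a b x : uniq A -> a \in A -> b \in A ->
  omega A (e a b x) = e a b (omega A x).
Proof.
move=> uA aA bA; rewrite /omega (linearB (e a b)) (linearZZ (e a b)).
rewrite (linear_sum (e a b)) (linear_sum (e a b)).
congr (_ - _); last first; first congr (_ *: _).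
  under eq_bigr do rewrite e_comm.
  rewrite sumrB big_split /= sum_deltaZ //.
  under [X in _ - X]eq_bigr do rewrite eq_sym.
  by rewrite sum_deltaZ // addrK.
under [RHS]eq_bigr do rewrite linear_sum.
pose F i j : M := (j == a)%:R *: e i b (e j i x) - (b == i)%:R *: e a j (e j i x)
  + ((i == a)%:R *: e i j (e j b x) - (b == j)%:R *: e i j (e a i x)).
have E i j : e i j (e j i (e a b x)) = e a b (e i j (e j i x)) + F i j.
  rewrite (e_comm j i a b) (linearB (e i j)) (linearD (e i j)) !(linearZZ (e i j)).
  by rewrite (e_comm i j a b) /F -!addrA (addrC (- _) (_ - _)) !addrA.
under [LHS]eq_bigr => i _.
  under eq_bigr => j _ do rewrite E.
  rewrite big_split; over.
rewrite big_split /= -[RHS]addr0; congr (_ + _); rewrite /F.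
under eq_bigr do rewrite big_split /= !sumrB.
rewrite big_split /= !sumrB.
under eq_bigr do rewrite sum_deltaZ //.
rewrite [X in _ - X + _]exchange_big /=.
under [X in _ - X + _]eq_bigr => j _.
  under eq_bigr do rewrite eq_sym. rewrite sum_deltaZ //. over.
rewrite [X in _ + (X - _)]exchange_big /=.
under [X in _ + (X - _)]eq_bigr do rewrite sum_deltaZ //.
under [X in _ + (_ - X)]eq_bigr => i _.
  under eq_bigr do rewrite eq_sym. rewrite sum_deltaZ //. over.
by rewrite addrC addrA subrK subrr.
Qed.

Hypothesis span_weights : forall x, fsum (fun u => exists chi, wvec chi u) x.
Hypothesis natk_weight : forall chi u i, wvec chi u -> u != 0 ->
  natk (chi (Some i)).
Hypothesis supp_weight : forall chi u, wvec chi u -> u != 0 ->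
  exists A, forall i, i \notin A -> chi (Some i) = 0.

Lemma covers_sub A B u : {subset A <= B} -> covers A u -> covers B u.
Proof. by move=> sAB cA i j jB; apply: cA; apply: contra jB => /sAB. Qed.

Lemma covers_subspace A : subspace (covers A).
Proof.
split=> [i j _|a u v cu cv i j jA]; first by rewrite raddf0.
by rewrite linearPZ cu // cv // scaler0 addr0.
Qed.

Lemma covers_e A a b u : a \in A -> covers A u -> covers A (e a b u).
Proof.
move=> aA cA i j jA; rewrite e_comm !(cA _ j) // raddf0 scaler0 subr0 add0r.
case: (eqVneq j a) => [ja|_]; first by rewrite ja aA in jA.
by rewrite scale0r.
Qed.

(** For a weight vector the support of its weight is enough: with [j] outside it, [e j j] acts by 0,
    and for i <> j the vector [e i j u] would have coordinate -1 at [j]. *)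
Lemma covers_ex u : exists A, uniq A /\ covers A u.
Proof.
apply: (fsum_ind (N := fun u => exists A, uniq A /\ covers A u)) (span_weights u).
- by exists [::]; split=> // i j _; rewrite raddf0.
- move=> x y [A [_ cA]] [B [_ cB]]; exists (undup (A ++ B)).
  split; first exact: undup_uniq.
  apply: (subspaceD (covers_subspace _)).
    by apply: covers_sub cA => i iA; rewrite mem_undup mem_cat iA.
  by apply: covers_sub cB => i iB; rewrite mem_undup mem_cat iB orbT.
- move=> {}u [chi wu]; have [->|un0] := eqVneq u 0.
    by exists [::]; split=> // i j _; rewrite raddf0.
  have [A sA] := supp_weight wu un0; exists (undup A).
  split=> [|i j]; rewrite ?undup_uniq // mem_undup => /sA jA.
  have [ij|ij] := eqVneq i j.
    have -> : e i j u = torus (Some i) u by rewrite /= ij.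
    by rewrite (wu (Some i)) ij jA scale0r.
  apply/eqP; apply: contraT => eun0.
  have [m] := natk_weight j (wvec_e i j wu) eun0.
  rewrite /addroot jA !(inj_eq Some_inj) eqxx eq_sym (negPf ij) add0r sub0r.
  by move/eqP; rewrite eq_sym -addr_eq0 -[1]/(1%:R) -natrD natr0P // addn1.
Qed.

(** The covering set is chosen arbitrarily for each vector; [casimirE] shows that the choice does
    not matter, so identities are checked on a common cover. *)
Definition casimir u : M := omega (projT1 (cid (covers_ex u))) u.

Lemma casimirE A u : uniq A -> covers A u -> casimir u = omega A u.
Proof.
rewrite /casimir; case: cid => B [uB cB] uA cA /=.
have uAB := undup_uniq (A ++ B).
rewrite -(omega_stable uA uAB _ cA) -?(omega_stable uB uAB _ cB) //.
  by move=> i iB; rewrite mem_undup mem_cat iB orbT.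
by move=> i iA; rewrite mem_undup mem_cat iA.
Qed.

Lemma covers_ex2 u v B : exists A,
  [/\ uniq A, covers A u, covers A v & {subset B <= A}].
Proof.
have [Au [_ cu]] := covers_ex u; have [Av [_ cv]] := covers_ex v.
exists (undup (Au ++ Av ++ B)); split; first exact: undup_uniq.
- by apply: covers_sub cu => i iA; rewrite mem_undup mem_cat iA.
- by apply: covers_sub cv => i iA; rewrite mem_undup !mem_cat iA orbT.
- by move=> i iA; rewrite mem_undup !mem_cat iA !orbT.
Qed.

Lemma omega_linear A : linear (omega A).
Proof.
move=> a u v; rewrite /omega scalerBr addrACA -opprD; congr (_ - _).
  rewrite scaler_sumr -big_split; apply: eq_bigr => i _ /=.
  rewrite scaler_sumr -big_split; apply: eq_bigr => j _ /=.
  by rewrite !linearPZ.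
rewrite scalerA mulrC -scalerA -scalerDr; congr (_ *: _).
rewrite scaler_sumr -big_split /=; apply: eq_bigr => i _; exact: linearPZ.
Qed.

Lemma casimir_linear : linear casimir.
Proof.
move=> a u v; have [A [uA cu cv _]] := covers_ex2 u v [::].
have cuv : covers A (a *: u + v) by case: (covers_subspace A) => _; apply.
by rewrite !(@casimirE A) // omega_linear.
Qed.

HB.instance Definition _ := GRing.isLinear.Build k M M *:%R casimir casimir_linear.

Lemma casimir_e i j u : casimir (e i j u) = e i j (casimir u).
Proof.
have [A [uA cu _ sA]] := covers_ex2 u u [:: i; j].
have iA : i \in A by apply: sA; rewrite inE eqxx.
have jA : j \in A by apply: sA; rewrite !inE eqxx orbT.
by rewrite !(@casimirE A) ?omega_comm //; apply: covers_e.
Qed.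

(** For [rk i < rk j] the raising operator is moved to the right by e_ij e_ji = e_ji e_ij + e_ii -
    e_jj. The opposite products are already in this order, hence two copies of [e j i (e i j v)];
    the scalars add up to [casval]. *)
Lemma casimir_wvec chi A v : wvec chi v -> uniq A -> covers A v ->
  casimir v = casval A chi *: v + \sum_(i <- A) \sum_(j <- A)
    (rk i < rk j)%N%:R *: (e j i (e i j v) + e j i (e i j v)).
Proof.
move=> wv uA cA; rewrite (casimirE uA cA) /omega.
pose c i := chi (Some i).
have eii i : e i i v = c i *: v by exact: (wv (Some i)).
pose G i j := (rk i < rk j)%N%:R *: e j i (e i j v).
pose f i j : k := (i == j)%:R * c i ^+ 2 + (rk i < rk j)%N%:R * (c i - c j).
have E i j : e i j (e j i v) = f i j *: v + (G i j + G j i).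
  rewrite /f /G; case: (ltngtP (rk i) (rk j)) => [ij|ji|/rk_inj <-].
  - have /negPf-> : i != j by apply: contraTneq ij => ->; rewrite ltnn.
    rewrite e_comm !eqxx !eii scale0r addr0 mul0r add0r mul1r !scale1r.
    by rewrite scalerBl -addrA addrC.
  - have /negPf-> : i != j by apply: contraTneq ji => ->; rewrite ltnn.
    by rewrite !mul0r addr0 !scale0r scale1r !add0r.
  - by rewrite eqxx mul0r !scale0r !addr0 mul1r eii linearZZ eii scalerA.
under eq_bigr => i _.
  under eq_bigr do rewrite E.
  rewrite big_split big_split -scaler_suml /=; over.
rewrite big_split -scaler_suml big_split /=.
rewrite [X in _ + (_ + X)]exchange_big -big_split /= addrAC.
congr (_ + _); last first.
  apply: eq_bigr => i _; rewrite -big_split; apply: eq_bigr => j _ /=.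
  by rewrite scalerDr.
under [X in _ - _ *: X]eq_bigr do rewrite eii.
rewrite -scaler_suml scalerA -scalerBl; congr (_ *: _).
have -> : \sum_(i <- A) \sum_(j <- A) f i j = \sum_(i <- A)
    (c i ^+ 2 + \sum_(j <- A) ((rk i < rk j)%N%:R - (rk j < rk i)%N%:R) * c i).
  under eq_bigr => i iA.
    rewrite /f big_split /=.
    under eq_bigr do rewrite eq_sym.
    rewrite sum_delta //. under [X in _ + X]eq_bigr do rewrite mulrBr.
    rewrite sumrB. over.
  rewrite big_split sumrB /= [X in _ + (_ - X)]exchange_big /=.
  rewrite big_split /=; congr (_ + _).
    by apply: eq_big_seq => i ->; rewrite mul1r.
  rewrite -sumrB; apply: eq_bigr => i _; rewrite -sumrB.
  by apply: eq_bigr => j _; rewrite mulrBl.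
rewrite mulr_sumr -sumrB /casval; apply: eq_bigr => i _.
rewrite -mulr_suml expr2 -mulrDl -mulrBl mulrC; congr (_ * _).
rewrite -/(c i) -addrA; congr (_ + _).
have -> : (size A)%:R = \sum_(j <- A) (1 : k).
  by rewrite big_const_seq count_predT iter_addr_0.
rewrite /rho -sumrB -[RHS]sumrN; apply: eq_bigr => j _.
by case: (ltngtP (rk i) (rk j)) => _ /=; ring.
Qed.

(** * Simplicity and complete reducibility *)

Lemma iter_addrootE i j chi r o : iter r (addroot i j) chi o =
  chi o + r%:R * ((o == Some i)%:R - (o == Some j)%:R).
Proof.
by elim: r => [|r IHr] /=; [ring|rewrite /addroot IHr -[r.+1]addn1 natrD; ring].
Qed.

(* sl_2-theory modulo S: if chi_i < chi_j for some i < j, no power of the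
   lowering operator e j i maps v into S, and eventually the weights become
   negative. *)
Lemma dominant_maximal S chi v : stable S -> wvec chi v -> ~ S v ->
  (forall i j, (rk i < rk j)%N -> S (e i j v)) -> dominant chi.
Proof.
move=> [sS eS _] wv nSv hv i j ij.
have vn0 : v != 0 by apply/eqP => v0; apply: nSv; rewrite v0; case: sS.
have [a chia] := natk_weight i wv vn0; have [b chib] := natk_weight j wv vn0.
rewrite chia chib; have [ba|ab] := leqP b a.
  by exists (a - b)%N; rewrite natrB.
have nij : (i == j) = false by apply: contraTF ij => /eqP ->; rewrite ltnn.
pose F r := iter r (e j i) v.
have wF r : wvec (iter r (addroot j i) chi) (F r).
  by elim: r => //= r; apply: wvec_e.
have E r : e i j (F r.+1) = e j i (e i j (F r)) + (a%:R - b%:R - r%:R - r%:R) *: F r.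
  have eii : e i i (F r) = (a%:R - r%:R) *: F r.
    have /= -> := wF r (Some i); rewrite iter_addrootE chia.
    by rewrite !(inj_eq Some_inj) eqxx nij /=; congr (_ *: _); ring.
  have ejj : e j j (F r) = (b%:R + r%:R) *: F r.
    have /= -> := wF r (Some j); rewrite iter_addrootE chib.
    by rewrite !(inj_eq Some_inj) eqxx eq_sym nij /=; congr (_ *: _); ring.
  rewrite -[F r.+1]/(e j i (F r)) e_comm !eqxx !scale1r eii ejj -addrA -scalerBl.
  by congr (_ + _ *: _); ring.
(* The sl_2 formula modulo [S]. Its coefficient never vanishes because a < b, so [F r.+1] in [S]
   would force [F r] into [S]. *)
have eF r : S (e i j (F r.+1) - (r.+1%:R * (a%:R - b%:R - r%:R)) *: F r).
  elim: r => [|r IHr].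
    rewrite E mul1r !subr0 addrK.
    by apply: eS; apply: hv.
  have := eS j i _ IHr; rewrite (linearB (e j i)) (linearZZ (e j i)).
  rewrite -[e j i (F r)]/(F r.+1) -scaleNr (E r.+1) -[X in _ -> S X]addrA -scalerBl.
  by congr S; congr (_ + _ *: _); rewrite -[r.+2]addn2 -[r.+1]addn1 !natrD; ring.
have nF r : ~ S (F r).
  elim: r => // r IHr SF; apply: IHr.
  have := subspaceB sS (eS i j _ SF) (eF r); rewrite subKr.
  move/(subspaceZ (r.+1%:R * (a%:R - b%:R - r%:R))^-1 sS).
  rewrite scalerA mulVf ?scale1r // mulf_neq0 ?natr0P //.
  rewrite -addrA -opprD -natrD subr_eq0 (inj_eq (natr_injective k0)).
  by rewrite ltn_eqF // ltn_addr.
(* After a + 1 lowerings the coordinate [i] has become -1, although the vector is not 0. *)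
have Fn0 : F a.+1 != 0 by apply/eqP => F0; apply: (nF a.+1); rewrite F0; case: sS.
have [m] := natk_weight i (wF a.+1) Fn0.
rewrite iter_addrootE chia !(inj_eq Some_inj) eqxx nij /= sub0r mulrN1 => /eqP.
by rewrite subr_eq -natrD (inj_eq (natr_injective k0)) ltn_eqF // addnS ltnS leq_addl.
Qed.

Lemma casimir_hwvec chi A v : hwvec chi v -> uniq A -> covers A v ->
  casimir v = casval A chi *: v.
Proof.
move=> [wv hv] uA cA; rewrite (casimir_wvec wv uA cA) big1 ?addr0 // => i _.
apply: big1 => j _; case: ltnP => [ij|_]; last exact: scale0r.
by rewrite hv // raddf0 addr0 scaler0.
Qed.

Lemma hwvec_dominant chi v : hwvec chi v -> v != 0 -> dominant chi.
Proof.
move=> [wv hv] vn0; apply: (@dominant_maximal (eq^~ 0)) wv _ hv; last exact/eqP.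
split=> [|i j x ->|x ->]; [|exact: raddf0|exact: raddf0].
by split=> // a x y -> ->; rewrite scaler0 addr0.
Qed.

Lemma exists_potential chi u : wvec chi u -> u != 0 ->
  exists (n : nat) A0, forall A, uniq A -> {subset A0 <= A} ->
  \sum_(i <- A) chi (Some i) * (rk i)%:R = n%:R.
Proof.
move=> wu un0; have [A sA] := supp_weight wu un0.
have [n Hn] : natk (\sum_(i <- undup A) chi (Some i) * (rk i)%:R).
  by apply: natk_sum => i _; apply: natkM; [apply: natk_weight wu un0|exists (rk i)].
exists n, A => B uB sB; rewrite -Hn (bigID (mem A)) /= [X in _ + X]big1 ?addr0.
  rewrite -big_filter; apply: perm_big; apply: uniq_perm.
  - exact: filter_uniq.
  - exact: undup_uniq.
  - move=> i; rewrite mem_filter mem_undup.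
    by case: (boolP (i \in A)) => // /sB.
by move=> i iA; rewrite sA // mul0r.
Qed.

(* Raising strictly decreases the potential sum_i chi_i * rk i, a natural
   number. *)
Lemma raising_ind (Q : M -> Prop) :
  (forall chi u, wvec chi u -> u != 0 ->
    (forall i j, (rk i < rk j)%N -> e i j u != 0 -> Q (e i j u)) -> Q u) ->
  forall chi u, wvec chi u -> u != 0 -> Q u.
Proof.
move=> HQ chi u wu un0; have [n [A HA]] := exists_potential wu un0.
elim/ltn_ind: n => n IHn in chi u A wu un0 HA *.
apply: (HQ _ _ wu un0) => i j ij en0.
have we := wvec_e i j wu; have [n' [A' HA']] := exists_potential we en0.
apply: (IHn n' _ _ _ A' we en0 HA').
have [A1 H1] := wlt_raise chi ij.
have uB := undup_uniq (A ++ A' ++ A1); set B := undup _ in uB.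
have sB i0 : i0 \in B = [|| i0 \in A, i0 \in A' | i0 \in A1].
  by rewrite mem_undup !mem_cat.
(* The pairing with the strictly decreasing function [- rk] expresses that raising lowers the
   potential. *)
have := H1 B uB _ (fun i => - (rk i)%:R).
under eq_bigr do rewrite mulrN mulrBl opprB.
rewrite sumrB HA ?HA' //; first 1 last.
- by move=> a aA; rewrite sB aA orbT.
- by move=> a aA; rewrite sB aA.
move=> H; apply: (posk_subn k0); apply: H.
  by move=> a aA; rewrite sB aA !orbT.
by move=> a b _ _ ab; rewrite opprK addrC; apply: natkB_posk.
Qed.

Lemma stable_torus N o u : stable N -> N u -> N (torus o u).
Proof. by move=> [_ eN zN]; case: o => [i|]; [apply: eN|apply: zN]. Qed.

Lemma casimir_gen v d x : casimir v = d *: v -> gen v x -> casimir x = d *: x.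
Proof.
move=> cv Gx; apply: (Gx (fun x => casimir x = d *: x)) => //.
split=> [|i j y cy|y].
- split=> [|a y y' cy cy']; first by rewrite raddf0 scaler0.
  by rewrite casimir_linear cy cy' scalerDr !scalerA mulrC.
- by rewrite casimir_e cy linearZZ.
- have [A [uA cy _ _]] := covers_ex2 y y [::] => Ey.
  have czy : covers A (z y) by move=> i j jA; rewrite -z_comm cy // raddf0.
  rewrite -(linearZZ z) -Ey !(@casimirE A) // /omega (linearB z) (linearZZ z).
  rewrite !(linear_sum z); congr (_ - _ *: _).
    apply: eq_bigr => i _; rewrite (linear_sum z).
    by apply: eq_bigr => j _; rewrite -!z_comm.
  by apply: eq_bigr => i _; rewrite -z_comm.
Qed.

(** Raising inside [N] produces a highest weight vector [u], of weight [mu]. Since the Casimir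
    operator is scalar on [gen v], [mu] cannot be strictly below [chi]; so only the empty lowering
    word contributes to [u], which is therefore a multiple of [v]. *)
Lemma gen_simple chi v N : hwvec chi v -> v != 0 -> stable N ->
  (forall x, N x -> gen v x) -> (exists2 x, N x & x != 0) -> N v.
Proof.
move=> hv vn0 sN Nv [x Nx xn0].
have [sN1 eN zN] := sN.
have [|chi1 [u1 [wu1 u1n0 Nu1]]] :=
    eigen_in_subspace (T := torus) sN1 _ (span_weights x) Nx xn0.
  by move=> o u; apply: stable_torus.
have [mu [u [hu un0 Nu]]] : exists mu u, [/\ hwvec mu u, u != 0 & N u].
  move: Nu1; apply: (raising_ind (Q := fun u => N u -> exists mu u,
    [/\ hwvec mu u, u != 0 & N u])) wu1 u1n0.
  move=> {chi1 u1}chi1 u1 w1 n1 IH N1.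
  have [H|] := pselect (forall i j, (rk i < rk j)%N -> e i j u1 = 0).
    by exists chi1, u1.
  move=> /existsNP[i /existsNP[j /not_implyP[ij /eqP en0]]].
  by apply: (IH i j) => //; apply: eN.
have [A1 [uA1 cv cu _]] := covers_ex2 v u [::].
have ncas : ~ wlt mu chi.
  move=> lt_mu.
  have [A0 HA0] := casval_lt (hwvec_dominant hu un0) (hwvec_dominant hv vn0) lt_mu.
  have [A [uA cAv cAu sA]] := covers_ex2 v u A0.
  have /posk_neq0 := HA0 A uA sA; move/(_ k0)/eqP; apply.
  have := casimir_gen (casimir_hwvec hv uA cAv) (Nv _ Nu).
  rewrite (casimir_hwvec hu uA cAu) => /eqP; rewrite -subr_eq0 -scalerBl.
  by rewrite scaler_eq0 (negPf un0) orbF subr_eq0 => /eqP ->; rewrite subrr.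
have : fsum (fun x => lowered predT v x /\ wvec mu x) u.
  apply: eigen_component hu.1 (gen_lowered hv (Nv _ Nu)).
  by move=> _ [c [w [_ ->]]]; eexists; apply/eigenZ/wvec_word/hv.1.
move/(fsum_min (N := fun x => exists c, x = c *: v)).
case=> [||c uE].
- split=> [|a _ _ [c ->] [d ->]]; first by exists 0; rewrite scale0r.
  by exists (a * c + d); rewrite scalerDl scalerA.
- move=> y [[c [w [lw yE]]] wy].
  have [y0|yn0] := eqVneq y 0; first by exists 0; rewrite scale0r.
  have wy' : wvec (wshift w chi) y by rewrite yE; apply/eigenZ/wvec_word/hv.1.
  have muE := eigen_uniq wy wy' yn0.
  have [w0|] := wlt_wshift chi lw; first by exists c; rewrite yE w0.
  by rewrite -muE => /ncas.
have cn0 : c != 0 by apply: contraNneq un0 => c0; rewrite uE c0 scale0r.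
by have := subspaceZ c^-1 sN1 Nu; rewrite uE scalerA mulVf // scale1r.
Qed.

Definition hwsum x :=
  fsum (fun u => exists chi v, [/\ hwvec chi v, v != 0 & gen v u]) x.

Lemma hwsum_stable : stable hwsum.
Proof.
split=> [|i j x|x].
- apply: fsum_subspace => a u [chi [v [hv vn0 Gu]]].
  by have [sG _ _] := gen_stable v; exists chi, v; split=> //; apply: (subspaceZ _ sG).
- apply: fsum_map => u [chi [v [hv vn0 Gu]]]; apply: fsum1.
  by exists chi, v; split=> //; have [_ eG _] := gen_stable v; apply: eG.
- apply: fsum_map => u [chi [v [hv vn0 Gu]]]; apply: fsum1.
  by exists chi, v; split=> //; have [_ _ zG] := gen_stable v; apply: zG.
Qed.

(** These vectors span a space on which [casimir - c] is invertible. *)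
Definition casimir_off c mu x :=
  [/\ wvec mu x, hwsum x & exists2 d, casimir x = d *: x & d != c].

Lemma casimir_offZ c mu : scale_closed (casimir_off c mu).
Proof.
move=> a x [wx hx [d cx dc]]; split; first exact: eigenZ.
  by have [sS _ _] := hwsum_stable; apply: (subspaceZ _ sS).
by exists d => //; rewrite linearZZ /= cx !scalerA mulrC.
Qed.

Lemma casimir_off_e c mu i j x : casimir_off c mu x ->
  casimir_off c (addroot i j mu) (e i j x).
Proof.
move=> [wx hx [d cx dc]]; split; first exact: wvec_e.
  by have [_ eS _] := hwsum_stable; apply: eS.
by exists d => //; rewrite casimir_e cx linearZZ.
Qed.

(** A summand of weight [mu] lies in a module of highest weight [lam], equal to [mu] or above it,
    hence strictly above [chi]; its Casimir value then differs from that of [chi]. *)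
Lemma hwsum_casimir_off c chi mu y : dominant chi -> wlt chi mu ->
  (exists A0, forall A, uniq A -> {subset A0 <= A} -> casval A chi = c) ->
  hwsum y -> wvec mu y -> fsum (casimir_off c mu) y.
Proof.
move=> dchi lt_chi [A0 HA0] hy wy.
pose B x := exists lam v w d, [/\ hwvec lam v, v != 0, all (lowering predT) w
  & x = d *: word ew w v].
have By : fsum B y.
  apply: (fsum_min _ _ hy).
    apply: fsum_subspace => a _ [lam [v [w [d [hv vn0 lw ->]]]]].
    by exists lam, v, w, (a * d); rewrite scalerA.
  move=> u [lam [v [hv vn0 /(gen_lowered hv)]]]; apply: fsum_sub.
  by move=> _ [d [w [lw ->]]]; exists lam, v, w, d.
apply: fsum_sub (eigen_component _ wy By); last first.
  move=> _ [lam [v [w [d [[wv _] _ _ ->]]]]].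
  by exists (wshift w lam); apply/eigenZ/wvec_word.
move=> x [[lam [v [w [d [hv vn0 lw xE]]]]] wx].
have Gx : gen v x.
  have [sG _ _] := gen_stable v; rewrite xE; apply: (subspaceZ _ sG).
  exact: (stable_word _ (gen_stable v)).
split=> //; first by apply: fsum1; exists lam, v.
have [x0|xn0] := eqVneq x 0.
  (* The zero vector is an eigenvector for any value; [c + 1] is merely one different from [c]. *)
  exists (c + 1); first by rewrite x0 scaler0 (raddf0 casimir).
  by rewrite -subr_eq0 addrC addKr oner_eq0.
have muE : mu = wshift w lam.
  by apply: eigen_uniq wx _ xn0; rewrite xE; apply/eigenZ/wvec_word/hv.1.
have lt_lam : wlt chi lam.
  have [w0|] := wlt_wshift lam lw; first by rewrite muE w0 in lt_chi.
  by rewrite -muE; apply: wlt_trans.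
have [A1 HA1] := casval_lt dchi (hwvec_dominant hv vn0) lt_lam.
have [A [uA cA _ sA]] := covers_ex2 v v (A0 ++ A1).
exists (casval A lam); first exact: casimir_gen (casimir_hwvec hv uA cA) Gx.
rewrite -subr_eq0 -(HA0 A uA) ?posk_neq0 //; first apply: HA1 => //.
  by move=> i iA; apply: sA; rewrite mem_cat iA orbT.
by move=> i iA; apply: sA; rewrite mem_cat iA.
Qed.

Lemma casimir_off_inv c mu s : fsum (casimir_off c mu) s ->
  exists2 y, fsum (casimir_off c mu) y & casimir y - c *: y = s.
Proof.
apply: (fsum_ind (N := fun s => exists2 y, _ & casimir y - c *: y = s)).
- by exists 0; [exact: fsum0|rewrite (raddf0 casimir) scaler0 subr0].
- move=> _ _ [y By <-] [y' By' <-]; exists (y + y'); first exact: fsumD.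
  by rewrite (raddfD casimir) scalerDr opprD addrACA.
- move=> u Bu; have [_ _ [d cu dc]] := Bu.
  exists ((d - c)^-1 *: u); first by apply/fsum1/casimir_offZ.
  rewrite (linearZZ casimir) /= cu !scalerA -scalerBl (mulrC c) -mulrBr.
  by rewrite mulVf ?scale1r // subr_eq0.
Qed.

Lemma addrootK i j chi : addroot j i (addroot i j chi) = chi.
Proof. by apply: funext => o; rewrite /addroot; ring. Qed.

(* A weight vector u that is highest modulo hwsum is corrected by an element
   y of hwsum into a genuine highest weight vector: the Casimir operator
   separates the weight of u from the strictly larger highest weights that
   occur in the vectors e i j u. *)
Lemma hwsum_maximal chi u : wvec chi u ->
  (forall i j, (rk i < rk j)%N -> hwsum (e i j u)) -> hwsum u.
Proof.
move=> wu Heu; apply: contrapT => nhu.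
have [sS eS zS] := hwsum_stable.
have dchi := dominant_maximal hwsum_stable wu nhu Heu.
have [A [uA cA]] := covers_ex u.
pose R B := \sum_(i <- B) \sum_(j <- B)
    (rk i < rk j)%N%:R *: (e j i (e i j u) + e j i (e i j u)).
have SR B : hwsum (R B).
  apply: (subspace_sum sS) => i _; apply: (subspace_sum sS) => j _.
  case: ltnP => [ij|_]; last by rewrite scale0r; case: sS.
  by apply: (subspaceZ _ sS); apply: (subspaceD sS); apply/eS/Heu.
set c := casval A chi.
(* If the value changed with the cover, comparing two expansions of [casimir u] would put a nonzero
   multiple of [u] into [hwsum]. *)
have cE : exists A0, forall B, uniq B -> {subset A0 <= B} -> casval B chi = c.
  exists A => B uB sAB; apply/eqP; rewrite -subr_eq0; apply: contraT => dn0.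
  exfalso; apply: nhu; rewrite -[u]scale1r -(mulVf dn0) -scalerA.
  apply: (subspaceZ _ sS); rewrite scalerBl.
  have cB := covers_sub sAB cA.
  suff -> : casval B chi *: u - c *: u = R A - R B by apply: (subspaceB sS).
  have := casimir_wvec wu uB cB; rewrite (casimir_wvec wu uA cA) => H.
  by apply: (addIr (R B)); rewrite subrK addrAC -H addrAC subrr add0r.
have off i j : (rk i < rk j)%N -> fsum (casimir_off c (addroot i j chi)) (e i j u).
  by move=> ij; apply: (hwsum_casimir_off dchi (wlt_raise chi ij) cE);
    [apply: Heu|apply: wvec_e].
have off_sub mu := fsum_subspace (@casimir_offZ c mu).
have offR : fsum (casimir_off c chi) (R A).
  apply: (subspace_sum (off_sub _)) => i _; apply: (subspace_sum (off_sub _)) => j _.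
  case: ltnP => [ij|_]; last by rewrite scale0r; apply: fsum0.
  apply: (subspaceZ _ (off_sub _)).
  suff H : fsum (casimir_off c chi) (e j i (e i j u)) by apply: fsumD.
  apply: fsum_map (off i j ij) => x /(@casimir_off_e _ _ j i); rewrite addrootK.
  exact: fsum1.
(* Solving [casimir y - c *: y = R A] makes [u - y] an eigenvector of the Casimir operator with
   value [c]. *)
have [y By Ry] := casimir_off_inv offR.
have yS : hwsum y by apply: (fsum_min sS _ By) => x [].
have wy : wvec chi y by apply: (fsum_min (eigen_subspace _ _) _ By) => x [].
have cx : casimir (u - y) = c *: (u - y).
  rewrite (raddfB casimir) /= (casimir_wvec wu uA cA) -/c -/(R A) -Ry scalerBr.
  by rewrite -addrA addrAC subrr add0r.
have hx : hwvec chi (u - y).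
  split; first exact: (subspaceB (eigen_subspace _ _)).
  (* [e i j (u - y)] has Casimir value [c] and is also a sum of vectors with other Casimir values,
     hence is 0. *)
  move=> i j ij; apply: (@eigen_sum_eq0 _ _ unit (fun _ => casimir) (fun _ => c)).
    by move=> _ /=; rewrite casimir_e cx linearZZ.
  apply: (@fsum_sub _ _ (casimir_off c (addroot i j chi))).
    by move=> x [_ _ [d cd dc]]; exists (fun _ => d); [move=> ?|exists tt].
  rewrite raddfB; apply: (subspaceB (off_sub _)); first exact: off.
  by apply: fsum_map By => x Bx; apply: fsum1; apply: casimir_off_e.
apply: nhu; rewrite -(subrK y u); apply: (subspaceD sS) => //.
have [->|xn0] := eqVneq (u - y) 0; first by case: sS.
by apply: fsum1; exists chi, (u - y); split.
Qed.

Lemma hwsum_full x : hwsum x.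
Proof.
have [sS _ _] := hwsum_stable.
apply: (fsum_min sS _ (span_weights x)) => u [chi wu].
have [->|un0] := eqVneq u 0; first by case: sS.
apply: (raising_ind (Q := hwsum) _ wu un0) => {}chi {}u {}wu {}un0 IH.
apply: (hwsum_maximal wu) => i j ij.
have [->|/(IH i j ij) //] := eqVneq (e i j u) 0; first by case: sS.
Qed.

(** * Extraction of a direct sum *)

Definition independent (D : M -> Prop) := forall (s : seq M) (f : M -> M),
  uniq s -> (forall v, v \in s -> D v /\ gen v (f v)) ->
  \sum_(v <- s) f v = 0 -> forall v, v \in s -> f v = 0.

(** A relation involves finitely many vectors, so it lives in one member of a chain and Zorn's lemma
    applies. If a highest weight vector [v] is missed by the sum [S] of a maximal family, simplicity
    gives a zero intersection of [gen v] with [S], and [v] could be added. *)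
Lemma simple_decomposition : exists D : M -> Prop,
  [/\ forall v, D v -> v != 0 /\ exists chi, hwvec chi v, independent D
    & forall x, fsum (fun u => exists2 v, D v & gen v u) x].
Proof.
pose P (D : set M) :=
  (forall v, D v -> v != 0 /\ exists chi, hwvec chi v) /\ independent D.
have [|D [[hD iD] maxD]] := @Zorn_bigcup M P.
  move=> F FP totF; split=> [v [X FX Xv]|s f us sD sf0 v sv].
    by have [H _] := FP _ FX; apply: H.
  have [X FX sX] : exists2 X, F X & forall u, u \in s -> X u.
    have [[X0 FX0 _] _] := sD v sv.
    have sF u : u \in s -> exists2 X, F X & X u by move=> /sD[].
    elim: s {us sD sf0 sv} sF => [|u s IHs] sF; first by exists X0.
    have [|X FX sX] := IHs; first by move=> t ts; apply: sF; rewrite inE ts orbT.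
    have [Y FY Yu] := sF u (mem_head _ _).
    have [XY|YX] := totF X Y FX FY; [exists Y|exists X] => // t;
      rewrite inE => /predU1P[->|/sX] //; [exact: XY|exact: YX].
  have [_ iX] := FP _ FX; apply: (iX s f us _ sf0 v sv) => u su.
  by split; [apply: sX|case: (sD _ su)].
exists D; split=> // x.
pose S := fsum (fun u => exists2 v, D v & gen v u).
have sS : stable S.
  split=> [|i j y|y].
  - apply: fsum_subspace => a u [v Dv Gu]; exists v => //.
    by have [sG _ _] := gen_stable v; apply: (subspaceZ _ sG).
  - apply: fsum_map => u [v Dv Gu]; apply: fsum1; exists v => //.
    by have [_ eG _] := gen_stable v; apply: eG.
  - apply: fsum_map => u [v Dv Gu]; apply: fsum1; exists v => //.
    by have [_ _ zG] := gen_stable v; apply: zG.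
have [sS1 eS zS] := sS.
apply: (fsum_min sS1 _ (hwsum_full x)) => u [chi [v [hv vn0 Gu]]].
apply: contrapT => nSu.
have nSv : ~ S v by move=> Sv; apply: nSu; apply: Gu.
have GS0 y : gen v y -> S y -> y = 0.
  move=> Gy Sy; apply/eqP; apply: contraT => yn0; exfalso; apply: nSv.
  have [sG eG zG] := gen_stable v.
  have sGS : stable (fun y => gen v y /\ S y).
    split=> [|i j t [Gt St]|t [Gt St]].
    - split=> [|a t t' [Gt St] [Gt' St']]; first by case: sG => ? _; case: sS1.
      by split; [case: sG => _; apply|case: sS1 => _; apply].
    - by split; [apply: eG|apply: eS].
    - by split; [apply: zG|apply: zS].
  have [||//] := gen_simple hv vn0 sGS; first by move=> ? [].
  by exists y.
apply: (maxD (fun t => D t \/ t = v)).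
  split=> [t Dt|sub]; first by left.
  apply: nSv; apply: fsum1; exists v => //; apply: sub; by right.
split=> [t [/hD //|->]|s f us sD sf0]; first by split=> //; exists chi.
have sD' t : t \in s -> t != v -> D t /\ gen t (f t).
  by move=> /sD[[//|->]]; rewrite eqxx.
have [vs|nvs] := boolP (v \in s); last first.
  apply: (iD s f us _ sf0) => t ts; apply: sD' => //.
  by apply: contraNneq nvs => <-.
have sf := sf0; rewrite (bigD1_seq v) //= -big_filter in sf.
set s' := [seq _ <- _ | _] in sf.
have s'D t : t \in s' -> D t /\ gen t (f t).
  by rewrite mem_filter => /andP[tv ts]; apply: sD'.
have Ss' : S (\sum_(t <- s') f t).
  by apply: subspace_sum => // t /s'D[Dt Gt]; apply: fsum1; exists t.
have fv0 : f v = 0.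
  apply: GS0; first by case: (sD v vs).
  move/eqP: sf; rewrite addr_eq0 => /eqP ->; rewrite -scaleN1r.
  exact: subspaceZ.
rewrite fv0 add0r in sf.
move=> t ts; have [-> //|tv] := eqVneq t v.
by apply: (iD s' f _ s'D sf t); rewrite ?filter_uniq // mem_filter tv.
Qed.

(** * Local finiteness of the simple modules *)

Lemma lowered_finite v x : fsum (lowered predT v) x ->
  exists B, forall B', {subset B <= B'} -> fsum (lowered (mem B') v) x.
Proof.
apply: (fsum_ind (N := fun x => exists B, forall B', {subset B <= B'} ->
  fsum (lowered (mem B') v) x)).
- by exists [::] => B' _; apply: fsum0.
- move=> y y' [B HB] [B' HB']; exists (B ++ B') => A sA.
  by apply: fsumD; [apply: HB|apply: HB'] => i iB; apply: sA;
    rewrite mem_cat iB ?orbT.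
- move=> _ [c [w [lw ->]]].
  exists ([seq p.1 | p <- w] ++ [seq p.2 | p <- w]) => B sB.
  apply: fsum1; exists c, w; split=> //; apply/allP => p pw.
  have /and3P[lp _ _] := allP lw p pw.
  by rewrite /lowering lp /=; apply/andP; split; apply: sB;
    rewrite mem_cat map_f ?orbT.
Qed.

Lemma lowered_lspan chi v B : hwvec chi v -> uniq B ->
  exists s, forall x, fsum (lowered (mem B) v) x -> lspan s x.
Proof.
move=> [wv _] uB; pose m := (\sum_(i <- B) rk i)%N.
have rkm i : i \in B -> (rk i <= m)%N.
  by move=> iB; rewrite /m (bigD1_seq i) //= leq_addr.
pose l := [seq p <- [seq (i, j) | i <- B, j <- B] | lowering (mem B) p].
(* A lowering operator moves one unit to a coordinate of larger rank, so this sum drops by the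
   difference of the ranks; [m] bounds the ranks in [B], which keeps it a natural number. *)
pose q w := \sum_(i <- B) wshift w chi (Some i) * (m - rk i)%:R.
have [||s Hs] := @decreasing_words_lspan k M _ ew l v q k0.
- move=> w _ wn0; apply: natk_sum => i _; apply: natkM; last by exists (m - rk i)%N.
  exact: natk_weight (wvec_word w wv) wn0.
- move=> [i j] w; rewrite mem_filter => /andP[/and3P[/= ji iB jB] _].
  rewrite /q -sumrB /= /addroot.
  under eq_bigr => a _.
    rewrite mulrDl opprD addrA subrr add0r !(inj_eq Some_inj) -mulNr opprB mulrBl.
    over.
  rewrite sumrB !sum_delta // iB jB !mul1r; apply: natkB_posk.
  by rewrite ltn_sub2l // (leq_trans ji) ?rkm.
- exists s => x; apply: fsum_min; first exact: lspan_subspace.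
  move=> _ [c [w [lw ->]]]; apply: subspaceZ; first exact: lspan_subspace.
  apply: Hs; apply/allP => p pw /=; have lp := allP lw p pw.
  rewrite mem_filter lp; have /and3P[_ p1 p2] := lp.
  by apply/allpairsP; exists p; split=> //; case: (p).
Qed.

(** Only finitely many indices occur in an expression of [x] by lowering words. Joined with [A] they
    give a finite set whose lowering words span a finite-dimensional space, stable under the
    corresponding [e i j] by the triangular decomposition. *)
Lemma gen_locally_finite chi v A x : hwvec chi v -> gen v x ->
  exists N s, [/\ subspace N, N x,
    forall i j y, i \in A -> j \in A -> N y -> N (e i j y),
    forall o y, N y -> N (torus o y) & forall y, N y -> lspan s y].
Proof.
move=> hv /(gen_lowered hv)/lowered_finite[B HB].
pose C := undup (A ++ B); have uC : uniq C := undup_uniq _.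
have [s Hs] := lowered_lspan hv uC.
exists (fsum (lowered (mem C) v)), s; split=> //.
- exact: lowered_subspace.
- by apply: HB => i iB; rewrite mem_undup mem_cat iB orbT.
- by move=> i j y iA jA; apply: (lowered_e hv); rewrite /= mem_undup mem_cat ?iA ?jA.
- by move=> o y; apply: (lowered_torus o hv.1).
Qed.

End PolynomialModule.

(** * Matrix units of gl_n and their action on a module *)

Section MatrixUnits.
Local Open Scope ring_scope.
Variables (k : fieldType) (n : option nat).
Implicit Types (i j a b : idx n) (A : gl k n).

(* Locked, as unification may otherwise unfold the arithmetic of {malg _}. *)
Definition munit i j : gl k n := locked << 1 *g (i, j) >>.

Lemma munitE i j : munit i j = << 1 *g (i, j) >>.
Proof. by rewrite /munit -lock. Qed.

Lemma munit_scale i j c : << c *g (i, j) >> = c *: munit i j.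
Proof.
apply/malgP => q; rewrite munitE mcoeffU mcoeffZ mcoeffU.
by rewrite mulrnAr mulr1.
Qed.

Lemma gl_mul_single A (p q : idx n * idx n) B :
  msupp A = [fset p]%fset -> msupp B = [fset q]%fset ->
  gl_mul A B = << A@_p * B@_q *+ (p.2 == q.1) *g (p.1, q.2) >>.
Proof. by move=> sA sB; rewrite /gl_mul sA sB !big_seq_fset1. Qed.

Lemma msupp_munit i j : msupp (munit i j) = [fset (i, j)]%fset.
Proof. by rewrite munitE (msuppU (i, j) 1) oner_eq0. Qed.

Lemma coef_munit i j : (munit i j)@_(i, j) = 1.
Proof. by rewrite munitE mcoeffUU. Qed.

Lemma munit_mul i j a b : gl_mul (munit i j) (munit a b) = (j == a)%:R *: munit i b.
Proof.
apply: etrans (gl_mul_single (msupp_munit i j) (msupp_munit a b)) _.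
by rewrite !coef_munit mulr1 munit_scale.
Qed.

Lemma munit_bracket i j a b : gl_bracket (munit i j) (munit a b) =
  (j == a)%:R *: munit i b - (b == i)%:R *: munit a j.
Proof. by rewrite /gl_bracket; congr (_ - _); apply: munit_mul. Qed.

Lemma unit_span_munit (P : rel nat) i j :
  unit_span P (munit i j) = P (val i) (val j).
Proof.
rewrite /unit_span msupp_munit (eq_all_r (s2 := [:: (i, j)])) /= ?andbT //.
by move=> p; rewrite !inE.
Qed.

Variable M : glmod k n.

Definition act_vec (v : M) A : M := act A v.
HB.instance Definition _ v :=
  GRing.isLinear.Build k (gl k n) M *:%R (act_vec v) (act_linearl v).

Definition act_mx A (v : M) : M := act A v.
HB.instance Definition _ A :=
  GRing.isLinear.Build k M M *:%R (act_mx A) (act_linear A).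

Definition munit_act i j : {linear M -> M} := act_mx (munit i j).

Lemma act_munits A (v : M) :
  act A v = \sum_(p <- msupp A) A@_p *: act (munit p.1 p.2) v.
Proof.
have -> : act A v = act_vec v (\sum_(p <- msupp A) << A@_p *g p >>).
  by rewrite -monalgE.
rewrite linear_sum; apply: eq_bigr => p _.
have -> : << A@_p *g p >> = A@_p *: munit p.1 p.2.
  by rewrite -munit_scale -surjective_pairing.
by rewrite (linearZZ (act_vec v)).
Qed.

Lemma act_unit_span (P : rel nat) A (N : M -> Prop) v : subspace N ->
  unit_span P A ->
  (forall i j, P (val i) (val j) -> N (act (munit i j) v)) -> N (act A v).
Proof.
move=> sN /allP PA HN; rewrite act_munits; apply: (subspace_sum sN) => p pA.
by apply: (subspaceZ _ sN); apply: HN; apply: PA.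
Qed.

Lemma munit_act_comm i j a b v : munit_act i j (munit_act a b v) =
  munit_act a b (munit_act i j v) + (j == a)%:R *: munit_act i b v
  - (b == i)%:R *: munit_act a j v.
Proof.
have : act_vec v (gl_bracket (munit i j) (munit a b)) =
    (j == a)%:R *: act_vec v (munit i b) - (b == i)%:R *: act_vec v (munit a j).
  rewrite munit_bracket (linearB (act_vec v)).
  by congr (_ - _); apply: (linearZZ (act_vec v)).
rewrite [LHS]act_bracket => /eqP; rewrite subr_eq => /eqP E.
by rewrite [LHS]E addrC addrA.
Qed.

Lemma generated_subspace (g : pred (gl k n)) (S : M -> Prop) :
  subspace (generated g S).
Proof.
split=> [N [] //|c u v Gu Gv N sN SN]; have [_ H _] := sN.
by apply: H; [apply: Gu|apply: Gv].
Qed.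

End MatrixUnits.

Lemma idx1_exists (n : option nat) : n <> Some 0%N ->
  exists i1 : idx n, val i1 = 1%N.
Proof.
move=> hn; have p1 : (0 < 1)%N && (if n is Some m then (1 <= m)%N else true).
  by case: n hn => [[]|].
by exists (Sub 1%N p1).
Qed.

(** * Restriction to the Levi subalgebra: condition P2 *)

Section LeviRestriction.
Local Open Scope ring_scope.
Variables (k : fieldType) (n : option nat) (M : glmod k n) (i1 : idx n).
Hypothesis k0 : [pchar k] =i pred0.
Hypothesis val_i1 : val i1 = 1%N.

Definition lidx : choiceType := {i : idx n | (2 <= val i)%N}.
Definition lrank (i : lidx) : nat := val (val i).
Definition levi_e (i j : lidx) : {linear M -> M} := munit_act M (val i) (val j).
Definition levi_z : {linear M -> M} := munit_act M i1 i1.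

Lemma lrank_inj : injective lrank.
Proof. by move=> i j /val_inj /val_inj. Qed.

Lemma lidx_neq (i : lidx) : (i1 == val i) = false.
Proof.
by apply: contraTF (valP i) => /eqP <-; rewrite /= val_i1.
Qed.

Lemma idx_split (i : idx n) : i = i1 \/ exists j : lidx, i = val j.
Proof.
have [i2|] := boolP (2 <= val i)%N; first by right; exists (Sub i i2).
rewrite -ltnNge ltnS => i2; left; apply/val_inj; rewrite /= val_i1.
have /andP[i0 _] := valP i.
by apply/eqP; rewrite eqn_leq i2 i0.
Qed.

Lemma le_comm i j a b x : levi_e i j (levi_e a b x) =
  levi_e a b (levi_e i j x) + (j == a)%:R *: levi_e i b x - (b == i)%:R *: levi_e a j x.
Proof.
apply: etrans (munit_act_comm (val i) (val j) (val a) (val b) x) _.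
by rewrite (inj_eq val_inj j a) (inj_eq val_inj b i).
Qed.

Lemma lz_comm i j x : levi_z (levi_e i j x) = levi_e i j (levi_z x).
Proof.
apply: etrans (munit_act_comm i1 i1 (val i) (val j) x) _.
rewrite lidx_neq (eq_sym (val j)) lidx_neq.
exact: etrans (sub_scale_false _ _) (add_scale_false _ _).
Qed.

Lemma weight_space_wvec beta u : weight_space beta u ->
  wvec levi_e levi_z (fun o => beta (if o is Some i then val i else i1)) u.
Proof.
have H i : weight_space beta u -> act (munit k i i) u = beta i *: u.
  move=> wu; rewrite wu; last by rewrite /cartan unit_span_munit.
  by rewrite msupp_munit big_seq_fset1 coef_munit mulr1.
by move=> wu [i|]; apply: H.
Qed.

(** [insub] sends the index 1 to [None], the place of [levi_z], so weights on [option lidx] become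
    weights on [1,n]. *)
Definition extend (chi : option lidx -> k) (i : idx n) : k :=
  chi (insub i).

Lemma extend_val chi j : extend chi (val j) = chi (Some j).
Proof. by rewrite /extend valK. Qed.

Lemma extend_i1 chi : extend chi i1 = chi None.
Proof. by rewrite /extend insubN //= val_i1. Qed.

Lemma wvec_weight_space chi u : wvec levi_e levi_z chi u -> weight_space (extend chi) u.
Proof.
move=> wu A /allP cA; rewrite act_munits scaler_suml.
apply: eq_big_seq => p /cA /eqP /val_inj <-.
rewrite mulrC -scalerA; congr (_ *: _).
have [->|[j ->]] := idx_split p.1; first by rewrite extend_i1; apply: (wu None).
by rewrite extend_val; apply: (wu (Some j)).
Qed.

Lemma act_levi A (N : M -> Prop) v : stable levi_e levi_z N -> levi A -> N v ->
  N (act A v).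
Proof.
move=> [sN eN zN] lA Nv; apply: (act_unit_span sN lA) => i j.
have [->|[{}i ->]] := idx_split i; have [->|[{}j ->]] := idx_split j => H.
- exact: zN.
- by move: H; rewrite (inj_eq val_inj) lidx_neq val_i1.
- by move: H; rewrite (inj_eq val_inj) eq_sym lidx_neq val_i1 andbF.
- exact: eN.
Qed.

Lemma submodule_levi (N : M -> Prop) :
  submodule (@levi k n) N <-> stable levi_e levi_z N.
Proof.
split=> [[N0 Nl lN]|sN].
  split=> [|i j x Nx|x Nx]; first by split.
    by apply: lN => //; rewrite /levi unit_span_munit (valP i) (valP j) orbT.
  by apply: lN => //; rewrite /levi unit_span_munit eqxx.
have [[N0 Nl] _ _] := sN; split=> // A v lA; exact: act_levi.
Qed.

Lemma fin_dim_subspace (N : M -> Prop) (s : seq M) : subspace N ->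
  (forall x, N x -> lspan s x) -> fin_dim N.
Proof. by move=> sN /(subspace_lspan sN)[s' Hs']; exists s'. Qed.

Definition lidx_upto (m : nat) : seq lidx := pmap insub (pmap insub (iota 0 m.+1)).

Lemma mem_lidx_upto m (i : lidx) : (lrank i <= m)%N -> i \in lidx_upto m.
Proof. by move=> im; rewrite !mem_pmap_sub mem_iota. Qed.

Hypothesis weights : direct_sum (@weight_space k n M).
Variable t : k.
Hypothesis Lambda_weight : forall beta,
  (exists2 v : M, weight_space beta v & v != 0) -> Lambda t beta.

Lemma lspan_weights x : fsum (fun u => exists chi, wvec levi_e levi_z chi u) x.
Proof.
have [m [j [y [wy ->]]]] := weights.1 x.
elim/big_ind: _ => [|u v|a _]; [exact: fsum0|exact: fsumD|].
by apply: fsum1; eexists; apply: weight_space_wvec (wy a).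
Qed.

Lemma lnatk_weight chi u i : wvec levi_e levi_z chi u -> u != 0 -> natk (chi (Some i)).
Proof.
move=> /wvec_weight_space wu un0.
have [|_ H _] := Lambda_weight (beta := extend chi); first by exists u.
by rewrite -extend_val; apply: (H (val i) (valP i)).
Qed.

Lemma lsupp_weight chi u : wvec levi_e levi_z chi u -> u != 0 ->
  exists A : seq lidx, forall i, i \notin A -> chi (Some i) = 0.
Proof.
move=> /wvec_weight_space wu un0.
have [|_ _ [s [_ H _]]] := Lambda_weight (beta := extend chi); first by exists u.
exists (pmap insub s) => i; rewrite mem_pmap_sub -extend_val; exact: H.
Qed.

Lemma gen_lidx_finite chi v (A : seq lidx) x : hwvec lrank levi_e levi_z chi v -> gen levi_e levi_z v x ->
  exists N s, [/\ subspace N, N x,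
    forall i j y, i \in A -> j \in A -> N y -> N (levi_e i j y),
    forall o y, N y -> N (torus levi_e levi_z o y) & forall y, N y -> lspan s y].
Proof. exact: (gen_locally_finite k0 lrank_inj le_comm lz_comm lnatk_weight). Qed.

Lemma gen_fin_dim chi v m : hwvec lrank levi_e levi_z chi v ->
  (forall i, (lrank i <= m)%N) -> fin_dim (gen levi_e levi_z v).
Proof.
move=> hv lm; have [sG _ _] := gen_stable levi_e levi_z v.
have [N [s [sN Nv eN zN Ns]]] := gen_lidx_finite (lidx_upto m) hv (@gen_id _ _ _ levi_e levi_z v).
apply: (fin_dim_subspace (s := s) sG) => x Gx; apply: Ns; apply: Gx => //.
split=> // [i j y|y]; first by apply: eN; apply: mem_lidx_upto.
exact: (zN None).
Qed.

Lemma gen_levi_upto_fin_dim chi v m x : hwvec lrank levi_e levi_z chi v ->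
  gen levi_e levi_z v x -> fin_dim (generated (@levi_upto k n m) (eq x)).
Proof.
move=> hv Gx; have [N [s [sN Nx eN zN Ns]]] := gen_lidx_finite (lidx_upto m) hv Gx.
apply: (fin_dim_subspace (s := s) (generated_subspace _ _)) => y Gy; apply: Ns.
apply: Gy => [|_ <- //]; have [N0 Nl] := sN; split=> // A u lA Nu.
apply: (act_unit_span sN lA) => i j.
have [->|[{}i ->]] := idx_split i; have [->|[{}j ->]] := idx_split j => H.
- exact: (zN None).
- by move: H; rewrite (inj_eq val_inj) lidx_neq val_i1.
- by move: H; rewrite (inj_eq val_inj) eq_sym lidx_neq val_i1 andbF.
- by have /and3P[_ im jm] := H; apply: eN => //; apply: mem_lidx_upto.
Qed.

Lemma gen_levi_finite chi v : hwvec lrank levi_e levi_z chi v ->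
  levi_finite (gen levi_e levi_z v).
Proof.
(* The types of [M] and [v] depend on [n], so the case distinction is made on a generic option. *)
have option_if (o : option nat) (P Q : Prop) :
    (forall m, o = Some m -> P) -> Q -> if o is Some _ then P else Q.
  by case: o => // m H _; apply: (H m).
move=> hv; apply: option_if => [m nm|m x]; last exact: gen_levi_upto_fin_dim hv.
apply: (gen_fin_dim (m := m) hv) => i; have := valP (val i).
by rewrite -/(lrank i); move: (lrank i) => r; rewrite nm => /andP[].
Qed.

Lemma P2_weight : P2 M.
Proof.
have [D [hD iD sD]] := simple_decomposition k0 lrank_inj le_comm lz_comm
  lspan_weights lnatk_weight lsupp_weight.
exists {v : M | D v}, (fun v => gen levi_e levi_z (sval v)); split=> [[v Dv] /=|].
  have [vn0 [chi hv]] := hD v Dv; split; last exact: gen_levi_finite hv.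
  split; first exact/submodule_levi/gen_stable.
    by exists v.
  move=> L /submodule_levi sL LG.
  have [H|/existsNP[x /not_implyP[Lx /eqP xn0]]] := pselect (forall x, L x -> x = 0).
    by left.
  right=> y Gy; apply: (Gy _ sL).
  apply: (gen_simple k0 lrank_inj le_comm lz_comm lspan_weights lnatk_weight
    lsupp_weight hv vn0 sL LG); by exists x.
split=> [x|m j x j_inj Gx x0 a].
  have [s [Ds ->]] := sD x.
  have /choice[j Hj] : forall i : 'I_(size s), exists v : {v : M | D v},
      gen levi_e levi_z (sval v) s`_i.
    move=> i; have [|v Dv Gv] := Ds s`_i; first exact: mem_nth.
    by exists (exist _ v Dv).
  exists (size s), j, (fun i => s`_i); split=> //.
  by rewrite (big_nth 0) big_mkord.
have sj_inj : injective (fun a => sval (j a)).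
  move=> b c bc; apply: j_inj; case: (j b) (j c) bc => [u Du] [u' Du'] /= uu'.
  by subst u'; congr exist; apply: Prop_irrelevance.
(* Independence is stated for functions of the generating vector; as [j] is injective, each such sum
   has at most one term. *)
pose f v := \sum_(b | sval (j b) == v) x b.
have fE b : f (sval (j b)) = x b.
  rewrite /f (big_pred1 b) // => c /=; exact: (inj_eq sj_inj).
rewrite -fE; apply: (iD [seq sval (j b) | b <- enum 'I_m]).
- by rewrite map_inj_uniq ?enum_uniq.
- by move=> _ /mapP[b _ ->]; rewrite fE; split=> //; apply: svalP.
- by rewrite big_map big_enum /= -[RHS]x0; apply: eq_bigr => b _; apply: fE.
- by apply: map_f; rewrite mem_enum.
Qed.

(** * Action of the nilpotent subalgebra: condition P3 *)

Definition raise1 (j : lidx) : {linear M -> M} := munit_act M i1 (val j).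

Lemma le_raise1 i j x :
  levi_e i i (raise1 j x) = raise1 j (levi_e i i x) - (i == j)%:R *: raise1 j x.
Proof.
apply: etrans (munit_act_comm (val i) (val i) i1 (val j) x) _.
rewrite (eq_sym (val i)) lidx_neq (inj_eq val_inj j i) (eq_sym j).
apply: etrans (congr1 (fun y => y - _) (add_scale_false _ _)) _.
have E : (i == j) -> munit_act M i1 (val i) x = raise1 j x by move=> /eqP ->.
exact: (congr1 (fun y => raise1 j (levi_e i i x) - y) (scale_bool E)).
Qed.

Lemma lz_raise1 j x : levi_z (raise1 j x) = raise1 j (levi_z x) + raise1 j x.
Proof.
apply: etrans (munit_act_comm i1 i1 i1 (val j) x) _.
rewrite eqxx (eq_sym (val j)) lidx_neq.
by apply: etrans (sub_scale_false _ _) _; congr (_ + _); apply: scale1r.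
Qed.

Lemma wvec_raise1 chi u j : wvec levi_e levi_z chi u ->
  wvec levi_e levi_z (fun o => if o is Some i then chi o - (i == j)%:R else chi o + 1)
    (raise1 j u).
Proof.
move=> wu [i|].
  apply: etrans (le_raise1 i j u) _; rewrite scalerBl; congr (_ - _).
  exact: etrans (congr1 (raise1 j) (wu (Some i))) (linearZZ _ _ _).
apply: etrans (lz_raise1 j u) _; rewrite scalerDl scale1r; congr (_ + _).
exact: etrans (congr1 (raise1 j) (wu None)) (linearZZ _ _ _).
Qed.

Lemma wvec_word_raise1 chi u w : wvec levi_e levi_z chi u ->
  wvec levi_e levi_z (fun o => if o is Some i then chi o - (count_mem i w)%:R
    else chi o + (size w)%:R) (word raise1 w u).
Proof.
move=> wu; elim: w => [|j w IHw] /=.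
  by move=> [i|]; rewrite ?subr0 ?addr0; apply: wu.
have := wvec_raise1 j IHw; congr wvec; apply: funext => -[i|] /=.
  by rewrite natrD opprD addrA addrAC (eq_sym i).
by rewrite -addrA natr1.
Qed.

(* E_{1,j} lowers the j-th coordinate of the weight, so that it only acts on a
   weight vector through the finitely many j in the support of its weight. *)
Lemma weight_nil_plus_finite x : exists N s, [/\ subspace N, N x,
  forall j y, N y -> N (raise1 j y) & forall y, N y -> lspan s y].
Proof.
apply: (fsum_ind (N := fun x => exists N s, [/\ subspace N, N x,
  forall j y, N y -> N (raise1 j y) & forall y, N y -> lspan s y]))
  (lspan_weights x) => [|u v|u [chi wu]].
- exists (eq^~ 0), [::]; split=> // [|j y ->|y ->]; last exact/lspan_nil.
    by split=> // a y z -> ->; rewrite scaler0 addr0.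
  exact: raddf0.
- move=> [N [s [sN Nu rN Ns]]] [N' [s' [sN' Nv rN' Ns']]].
  exists (fun y => exists y1 y2, [/\ N y1, N' y2 & y = y1 + y2]), (s ++ s').
  split=> [||j _ [y1 [y2 [N1 N2 ->]]]|_ [y1 [y2 [N1 N2 ->]]]].
  + split=> [|a _ _ [y1 [y2 [N1 N2 ->]]] [z1 [z2 [M1 M2 ->]]]].
      by exists 0, 0; rewrite addr0; case: sN sN' => ? _ [].
    exists (a *: y1 + z1), (a *: y2 + z2); rewrite scalerDr addrACA.
    by split=> //; [case: sN => _; apply|case: sN' => _; apply].
  + by exists u, v.
  + by exists (raise1 j y1), (raise1 j y2); rewrite raddfD; split; auto.
  + apply: (subspaceD (lspan_subspace _)); first exact/lspan_catl/Ns.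
    exact/lspan_catr/Ns'.
- have [u0|un0] := eqVneq u 0.
    exists (eq^~ 0), [::]; split=> // [|j y ->|y ->]; last exact/lspan_nil.
      by split=> // a y z -> ->; rewrite scaler0 addr0.
    exact: raddf0.
  have [A0 sA0] := lsupp_weight wu un0; pose A := undup A0.
  have uA : uniq A := undup_uniq _.
  have sA i : i \notin A -> chi (Some i) = 0 by rewrite mem_undup; apply: sA0.
  (* The total weight on the support [A]; every letter of a word in [A] lowers it by exactly 1. *)
  pose q w := \sum_(i <- A) (chi (Some i) - (count_mem i w)%:R).
  have [||s Hs] := @decreasing_words_lspan k M _ raise1 A u q k0.
  + move=> w _ wn0; apply: natk_sum => i _.
    exact: (lnatk_weight i (wvec_word_raise1 w wu) wn0).
  + move=> j w jA; exists 0%N; rewrite /q -sumrB.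
    have E i : chi (Some i) - (count_mem i w)%:R -
        (chi (Some i) - (count_mem i (j :: w))%:R) = (i == j)%:R * 1.
      by rewrite /= natrD (eq_sym j); ring.
    by rewrite (eq_bigr _ (fun i _ => E i)) sum_delta // jA mulr1.
  exists (fsum (fun y => exists c w, all (mem A) w /\ y = c *: word raise1 w u)), s.
  have sN : subspace (fsum (fun y => exists c w,
      all (mem A) w /\ y = c *: word raise1 w u)).
    apply: fsum_subspace => a _ [c [w [wA ->]]].
    by exists (a * c), w; rewrite scalerA.
  split=> // [|j y|y].
  + by apply: fsum1; exists 1, [::]; rewrite scale1r.
  + apply: fsum_map => _ [c [w [wA ->]]]; rewrite linearZZ.
    apply: (subspaceZ _ sN); have [jA|jA] := boolP (j \in A).
      by apply: fsum1; exists 1, (j :: w); rewrite scale1r /= jA.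
    have [->|rn0] := eqVneq (raise1 j (word raise1 w u)) 0; first exact: fsum0.
    (* For [j] outside the support the coordinate [j] would become negative, so the vector is 0. *)
    have [m] := lnatk_weight j (wvec_word_raise1 (j :: w) wu) rn0.
    rewrite sA // sub0r /= eqxx => /eqP; rewrite eq_sym -addr_eq0 -natrD natr0P //.
    by rewrite addnC.
  + apply: fsum_min; first exact: lspan_subspace.
    move=> _ [c [w [wA ->]]]; apply: (subspaceZ _ (lspan_subspace _)); exact: Hs.
Qed.

Lemma P3_weight : P3 M.
Proof.
move=> v; have [N [s [sN Nv rN Ns]]] := weight_nil_plus_finite v.
apply: (fin_dim_subspace (s := s) (generated_subspace _ _)) => y Gy; apply: Ns.
apply: Gy => [|_ <- //]; have [N0 Nl] := sN; split=> // A u lA Nu.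
apply: (act_unit_span sN lA) => i j /andP[/eqP iE j2].
have -> : i = i1 by apply: val_inj; rewrite iE val_i1.
exact: (rN (Sub j j2)).
Qed.

End LeviRestriction.

Theorem lemma8p7p1 (k : fieldType) (hk : [pchar k]%R =i pred0) (t : k)
    (n : option nat) (hn : n <> Some 0) :
  full_subcategory (@category_P k n t) (@category_Op k n).
Proof.
(* Both categories have the same morphisms, which settles fullness, and share finite generation; P2
   and P3 remain. *)
split=> // M [fgM wM LM].
have [i1 val_i1] := idx1_exists hn.
by split; [|apply: (P2_weight hk val_i1 wM LM)|apply: (P3_weight hk val_i1 wM LM)].
Qed.
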